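(* Let $R$ be a skew-invertible Hecke symmetry. The map $$l_i^j[1]\mapsto a_i^+a^kB_k^j+\frac{\delta_i^j}{q-q^{-1}},\qquad L[k]\mapsto0,\quad k\ge2,$$ where $a_i^+$, $a^j$ are the creation and annihilation operators on the Fock space $\mathcal{F}(R)$, is a representation of the braided Yangian $\mathbf{Y}(R)$ associated with $R$ (in the space $\mathcal{F}(R)$).
   Context: $V$ is an $N$-dimensional vector space over $\mathbb{K}=\mathbb{R}$ or $\mathbb{C}$ with a fixed basis $\{x_i\}$; an operator $R$ on $V^{\otimes 2}$ has matrix given by $R(x_i\otimes x_j)=R_{ij}^{ks}x_k\otimes x_s$ (summation over repeated indices); matrix products are $(AB)_i^j=A_i^kB_k^j$; $L_1=L\otimes I$, $R_{12}=R\otimes I$, $R_{23}=I\otimes R$. Hecke symmetry: $R_{12}R_{23}R_{12}=R_{23}R_{12}R_{23}$ and $(qI-R)(q^{-1}I+R)=0$, with $q\in\mathbb{K}$ nonzero and generic ($q^n\neq1$ for all nonzero integers $n$). Skew-invertible: there is $\Psi$ on $V^{\otimes 2}$ with $R_{ij}^{kl}\Psi_{lp}^{jq'}=\delta_i^{q'}\delta_p^k$. Put $B_i^j=\Psi_{ki}^{kj}$. Fock space and operators: $\mathcal{F}(R)=\mathrm{Sym}_R(V)=T(V)/\langle q\,x_ix_j-R_{ij}^{ab}x_ax_b\rangle$. Let $\{\tilde x^j\}$ be the left dual basis of $V^*$ (that is, $\langle\tilde x^j,x_i\rangle=\delta_i^j$) and $\mathrm{Sym}_R(V^* )=T(V^*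 )/\langle q\,\tilde x^i\tilde x^j-R^{ji}_{lk}\tilde x^k\tilde x^l\rangle$. The permutation relations $\tilde x^ix_j=\delta^i_j+q^{-1}x_k\tilde x^l(R^{-1})_{jl}^{ik}$ allow one to move elements of $\mathrm{Sym}_R(V^* )$ to the right of elements of $\mathrm{Sym}_R(V)$. For $f\in\mathcal{F}(R)$, $\tilde x^i(f)$ is obtained by moving $\tilde x^i$ through $f$ to the right and then applying the counit of $\mathrm{Sym}_R(V^* )$ (identity on $\mathbb{K}$, zero on elements of positive degree); so $\tilde x^j(1)=0$, $\tilde x^j(x_i)=\delta_i^j$. The creation and annihilation operators are $a_i^+(f)=x_if$, $a^i(f)=\tilde x^i(f)$. Braided Yangian: let $R(u,v)=R-\frac{u(q-q^{-1})}{u-v}I$. $\mathbf{Y}(R)$ is the unital associative algebra generated by the entries $l_i^j[k]$ ($k\ge1$) of matrices $L[k]$, where $L(u)=\sum_{k\ge0}L[k]u^{-k}$, $L[0]=I$, subject to the relations obtained by expanding $R(u,v)L_1(u)RL_1(v)=L_1(v)RL_1(u)R(u,v)$.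
   Formalization: The sign of the scalar term is corrected: the theorem proves the representation with $-\delta_i^j/(q-q^{-1})$ in place of the printed $+\delta_i^j/(q-q^{-1})$, for which the claim fails for every N ≥ 2, for example for the standard GL_q(2) symmetry. *)

(* Defs.v *)
From HB Require Import structures.
From mathcomp Require Import all_boot all_order all_algebra.
From mathcomp Require Import boolp classical_sets reals.
From mathcomp Require Import complex mxtens.
From mathcomp Require Import monalg.

Set Implicit Arguments.
Unset Strict Implicit.
Unset Printing Implicit Defensive.

Import GRing.Theory.
Local Open Scope ring_scope.
Local Open Scope quotient_scope.

Definition scalars (RR : realType) (cplx : bool) : fieldType :=
  if cplx then (RR[i] : fieldType) else (RR : fieldType).

Section Quotients.
Variables (K : fieldType) (A : lalgType K).

Inductive ideal (S : A -> Prop) : A -> Prop :=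
| ideal_gen a of S a : ideal S a
| ideal0 : ideal S 0
| idealD a b of ideal S a & ideal S b : ideal S (a + b)
| idealMl a b of ideal S b : ideal S (a * b)
| idealMr a b of ideal S a : ideal S (a * b).

Variable S : A -> Prop.

Lemma idealZ c a : ideal S a -> ideal S (c *: a).
Proof. by rewrite -mulr_algl; apply: idealMl. Qed.

Lemma idealN a : ideal S a -> ideal S (- a).
Proof. by rewrite -scaleN1r; apply: idealZ. Qed.

Definition ideal_equiv (a b : A) : bool := `[< ideal S (a - b) >].

Lemma ideal_equiv_equiv : equiv_class_of ideal_equiv.
Proof.
split=> [a | a b | b a c]; rewrite /ideal_equiv.
- by rewrite subrr; apply/asboolP; apply: ideal0.
- by apply/asboolP/asboolP => /idealN; rewrite opprB.
- move=> /asboolP ab /asboolP bc; apply/asboolP.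
  by rewrite -(subrKA b); apply: idealD.
Qed.

Canonical ideal_equivR := EquivRelPack ideal_equiv_equiv.

(* The algebra A / (S). It may be zero, which is why it carries a pzRingType
   and an lmodType structure instead of an algType structure. *)
Definition quot := {eq_quot ideal_equiv}.
HB.instance Definition _ := EqQuotient.on quot.
HB.instance Definition _ := Choice.on quot.

Definition cls (a : A) : quot := \pi a.

Lemma eq_cls a b : cls a = cls b <-> ideal S (a - b).
Proof.
split=> [/eqmodP/asboolP //| ab].
by apply/eqmodP/asboolP.
Qed.

Lemma cls_reprK (x : quot) : cls (repr x) = x. Proof. exact: reprK. Qed.

Lemma repr_cls a : ideal S (repr (cls a) - a).
Proof. by apply/eq_cls; rewrite cls_reprK. Qed.

Definition quot_add (x y : quot) := cls (repr x + repr y).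
Definition quot_opp (x : quot) := cls (- repr x).
Definition quot_mul (x y : quot) := cls (repr x * repr y).
Definition quot_scale c (x : quot) := cls (c *: repr x).

Lemma cls_add a b : quot_add (cls a) (cls b) = cls (a + b).
Proof.
by apply/eq_cls; rewrite opprD addrACA; apply: idealD; apply: repr_cls.
Qed.

Lemma cls_opp a : quot_opp (cls a) = cls (- a).
Proof. by apply/eq_cls; rewrite -opprD; apply/idealN/repr_cls. Qed.

Lemma cls_mul a b : quot_mul (cls a) (cls b) = cls (a * b).
Proof.
apply/eq_cls; rewrite -(subrKA (a * repr (cls b))) -mulrBl -mulrBr.
by apply: idealD; [apply: idealMr | apply: idealMl]; apply: repr_cls.
Qed.

Lemma cls_scale c a : quot_scale c (cls a) = cls (c *: a).
Proof. by apply/eq_cls; rewrite -scalerBr; apply/idealZ/repr_cls. Qed.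

Lemma clsP (x : quot) : exists a, x = cls a.
Proof. by exists (repr x); rewrite cls_reprK. Qed.

Lemma quot_addA : associative quot_add.
Proof.
move=> x y z; have [[a ->] [b ->] [c ->]] := And3 (clsP x) (clsP y) (clsP z).
by rewrite !cls_add addrA.
Qed.

Lemma quot_addC : commutative quot_add.
Proof. by move=> x y; rewrite /quot_add addrC. Qed.

Lemma quot_add0 : left_id (cls 0) quot_add.
Proof. by move=> x; have [a ->] := clsP x; rewrite cls_add add0r. Qed.

Lemma quot_addN : left_inverse (cls 0) quot_opp quot_add.
Proof. by move=> x; have [a ->] := clsP x; rewrite cls_opp cls_add addNr. Qed.

HB.instance Definition _ :=
  GRing.isZmodule.Build quot quot_addA quot_addC quot_add0 quot_addN.

Lemma quot_mulA : associative quot_mul.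
Proof.
move=> x y z; have [[a ->] [b ->] [c ->]] := And3 (clsP x) (clsP y) (clsP z).
by rewrite !cls_mul mulrA.
Qed.

Lemma quot_mul1 : left_id (cls 1) quot_mul.
Proof. by move=> x; have [a ->] := clsP x; rewrite cls_mul mul1r. Qed.

Lemma quot_mulr1 : right_id (cls 1) quot_mul.
Proof. by move=> x; have [a ->] := clsP x; rewrite cls_mul mulr1. Qed.

Lemma quot_mulDl : left_distributive quot_mul +%R.
Proof.
move=> x y z; have [[a ->] [b ->] [c ->]] := And3 (clsP x) (clsP y) (clsP z).
by rewrite -[cls a + _]/(quot_add _ _) -[RHS]/(quot_add _ _)
           !(cls_add, cls_mul) mulrDl.
Qed.

Lemma quot_mulDr : right_distributive quot_mul +%R.
Proof.
move=> x y z; have [[a ->] [b ->] [c ->]] := And3 (clsP x) (clsP y) (clsP z).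
by rewrite -[cls b + _]/(quot_add _ _) -[RHS]/(quot_add _ _)
           !(cls_add, cls_mul) mulrDr.
Qed.

HB.instance Definition _ := GRing.Zmodule_isPzRing.Build quot
  quot_mulA quot_mul1 quot_mulr1 quot_mulDl quot_mulDr.

Lemma quot_scaleA c d x : quot_scale c (quot_scale d x) = quot_scale (c * d) x.
Proof. by have [a ->] := clsP x; rewrite !cls_scale scalerA. Qed.

Lemma quot_scale1 : left_id 1 quot_scale.
Proof. by move=> x; have [a ->] := clsP x; rewrite cls_scale scale1r. Qed.

Lemma quot_scaleDr : right_distributive quot_scale +%R.
Proof.
move=> c x y; have [[a ->] [b ->]] := conj (clsP x) (clsP y).
by rewrite -[cls a + _]/(quot_add _ _) -[RHS]/(quot_add _ _)
           !(cls_add, cls_scale) scalerDr.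
Qed.

Lemma quot_scaleDl x : {morph quot_scale^~ x : c d / c + d}.
Proof.
move=> c d; have [a ->] := clsP x.
by rewrite -[RHS]/(quot_add _ _) !(cls_add, cls_scale) scalerDl.
Qed.

HB.instance Definition _ := GRing.Zmodule_isLmodule.Build K quot
  quot_scaleA quot_scale1 quot_scaleDr quot_scaleDl.

End Quotients.

Section FreeAlgebras.
Variables (K : fieldType) (I : choiceType).

Definition free_alg : lalgType K := {malg K[{fmonom I}]}.

Definition gen (i : I) : free_alg := << fmu i >>.

Definition const_term (f : free_alg) : K := mcoeff (@fmone I) f.

End FreeAlgebras.

(* The algebra morphism sending the letter i to the letter s i. *)
Definition free_map (K : fieldType) (I J : choiceType) (s : I -> J)
    (f : free_alg K I) : free_alg K J :=
  \sum_(m <- finmap.enum_fset (msupp f)) mcoeff m f *: \prod_(i <- m : seq I) gen K (s i).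

Section HeckeSymmetries.
Variables (K : fieldType) (N : nat).

(* Matrices act on rows: the lower indices of R_{ij}^{ks} label rows and the
   upper ones label columns. *)
Definition entry (M : 'M[K]_(N * N)) (i j k s : 'I_N) : K :=
  M (mxtens_index (i, j)) (mxtens_index (k, s)).

Definition R12 (R : 'M[K]_(N * N)) : 'M[K]_(N * N * N) := R *t 1%:M.
Definition R23 (R : 'M[K]_(N * N)) : 'M[K]_(N * N * N) :=
  castmx (mulnA N N N, mulnA N N N) (1%:M *t R).

Definition hecke_symmetry (q : K) (R : 'M[K]_(N * N)) : Prop :=
  R12 R *m R23 R *m R12 R = R23 R *m R12 R *m R23 R /\
  (q%:M - R) *m (q^-1%:M + R) = 0.

Definition skew_inverse (R Psi : 'M[K]_(N * N)) : Prop :=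
  forall i k p s : 'I_N,
    \sum_j \sum_l entry R i j k l * entry Psi l p j s
    = (i == s)%:R * (p == k)%:R.

Definition Bmx (Psi : 'M[K]_(N * N)) : 'M[K]_N :=
  \matrix_(i, j) \sum_k entry Psi k i k j.

End HeckeSymmetries.

Section FockSpace.
Variables (K : fieldType) (N : nat) (q : K) (R : 'M[K]_(N * N)).

Definition sym_rel (i j : 'I_N) : free_alg K 'I_N :=
  q *: (gen K i * gen K j)
  - \sum_a \sum_b entry R i j a b *: (gen K a * gen K b).

Definition fock := quot (fun z => exists i j, z = sym_rel i j).

Definition dual_rel (i j : 'I_N) : free_alg K 'I_N :=
  q *: (gen K i * gen K j)
  - \sum_k \sum_l entry R l k j i *: (gen K k * gen K l).

(* Free algebra on the letters x_i = inl i and \tilde x^i = inr i. *)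
Local Notation TVV := (free_alg K ('I_N + 'I_N)%type).
Definition in_V : free_alg K 'I_N -> TVV := free_map inl.
Definition in_dual : free_alg K 'I_N -> TVV := free_map inr.

Definition perm_rel (i j : 'I_N) : TVV :=
  gen K (inr i) * gen K (inl j)
  - ((i == j)%:R + q^-1 *: \sum_k \sum_l
       entry (invmx R) j l i k *: (gen K (inl k) * gen K (inr l))).

Definition double_rel (z : TVV) : Prop :=
  exists i j, [\/ z = in_V (sym_rel i j), z = in_dual (dual_rel i j)
                | z = perm_rel i j].

(* g is the result of moving \tilde x^i to the right through f, which gives a sum
   of products u v with u in Sym_R(V) and v in Sym_R(V^* ), and then applying the
   counit to the factors v. Elements of the symmetric algebras are given by
   representatives in tensor algebras. The counit is the constant term: it does
   not depend on the representative because the relations are quadratic. *)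
Definition moves_to (i : 'I_N) (f g : fock) : Prop :=
  exists (f0 : free_alg K 'I_N) (s : seq (free_alg K 'I_N * free_alg K 'I_N)),
  [/\ f = cls _ f0,
      ideal double_rel
        (gen K (inr i) * in_V f0 - \sum_(p <- s) in_V p.1 * in_dual p.2)
    & g = \sum_(p <- s) const_term p.2 *: cls _ p.1].

Definition creation (i : 'I_N) (f : fock) : fock := cls _ (gen K i) * f.

(* For a Hecke symmetry there is exactly one such g: the double acts on the Fock
   space, with \tilde x^i killing 1, so that \tilde x^i f is recovered by letting
   the double act on 1. The default value 0 of xget is then never used. *)
Definition annihilation (i : 'I_N) (f : fock) : fock :=
  xget 0 [set g | moves_to i f g]%classic.

End FockSpace.

Section BraidedYangian.
Variables (K : fieldType) (N : nat) (q : K) (R : 'M[K]_(N * N)).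

(* The letter (i, j, k) stands for l_i^j[k + 1]. *)
Local Notation T := (free_alg K ('I_N * 'I_N * nat)%type).

Definition Lfree (k : nat) : 'M[T]_N :=
  if k is k'.+1 then \matrix_(i, j) gen K (i, j, k') else 1%:M.

Definition Lpred (k : nat) : 'M[T]_N := if k is k'.+1 then Lfree k' else 0.

Definition sc (M : 'M[K]_(N * N)) : 'M[T]_(N * N) := map_mx (in_alg T) M.

Definition L1 (L : 'M[T]_N) : 'M[T]_(N * N) := L *t 1%:M.

(* Lpred r and Lpred s below are L[r - 1] and L[s - 1], with L[-1] = 0.
   Coefficient of u^(1-r) v^(1-s) in the difference of the two sides of the
   defining relation multiplied by u - v; note that
   (u - v) R(u,v) = u (R - (q - q^-1) I) - v R. *)
Definition yangian_rel (r s : nat) : 'M[T]_(N * N) :=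
  let Rq := R - (q - q^-1)%:M in
    (sc Rq *m L1 (Lfree r) *m sc R *m L1 (Lpred s)
     - sc R *m L1 (Lpred r) *m sc R *m L1 (Lfree s))
  - (L1 (Lpred s) *m sc R *m L1 (Lfree r) *m sc Rq
     - L1 (Lfree s) *m sc R *m L1 (Lpred r) *m sc R).

Definition yangian :=
  quot (fun z : T => exists r s a b, z = yangian_rel r s a b).

Definition Lgen (k : nat) : 'M[yangian]_N := map_mx (@cls _ _ _) (Lfree k).

End BraidedYangian.

(* rho is a morphism of unital K-algebras from A / (S) to End_K(M). *)
Definition representation (K : fieldType) (A : lalgType K) (S : A -> Prop)
    (M : lmodType K) (rho : quot S -> M -> M) : Prop :=
  [/\ forall a, linear (rho a),
      forall c a b f, rho (c *: a + b) f = c *: rho a f + rho b f,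
      forall f, rho 1 f = f
    & forall a b f, rho (a * b) f = rho a (rho b f)].

(* Main.v *)
Require Import Defs.
From HB Require Import structures.
From mathcomp Require Import all_boot all_order all_algebra.
From mathcomp Require Import classical_sets reals mxtens finmap monalg.

Set Implicit Arguments.
Unset Strict Implicit.
Unset Printing Implicit Defensive.

Import GRing.Theory.
Local Open Scope ring_scope.

(** Write [x_i] and [d^i] for the creation and annihilation operators and
    [M = x d B] for the matrix of the bilinear operators [x_i d^k B_k^j].

    The operators [d^i] are obtained from an action of the Fock space on
    [F + F^N]: let [x_j] send [(f, (g_i))] to
    [(x_j f, (delta^i_j f + q^-1 x_k (R^-1)_(jl)^(ik) g_l))]. By the braid
    relation these operators satisfy the relations of [Sym_R(V)], so [f] acts, and
    [d^i f] is the i-th component of [f (1, 0)]. The double then acts on [F], and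
    letting it act on the vacuum shows that reordering can only give [d^i f].

    Contracting the braid relation with the skew inverse gives
    [Tr_1 (B_1 R) = I], [Tr_1 (B_1 R X_2 R^-1) = Tr (B X) I] and
    [B_1 B_2 R = R B_1 B_2]. The first two and the permutation relations reorder
    the inner [d R x] in [M_1 R M_1], which becomes [M_1 + q^-1 x x d d B B]; the
    quadratic part commutes with [R] by the relations [R x x = q x x],
    [R d d = q d d] and the third identity. Hence
    [R M_1 R M_1 - M_1 R M_1 R = R M_1 - M_1 R], and as [R^2 = 1 + (q - q^-1) R], the
    shifted matrix [M - 1 / (q - q^-1)] satisfies the homogeneous reflection
    equation, to which all the Yangian relations reduce. *)

(** * Actions of free algebras *)

Section LinearExtension.
Variables (K : fieldType) (M : choiceType) (V : lmodType K).

Definition lext (h : M -> V) (f : {malg K[M]}) : V :=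
  \sum_(m <- msupp f) mcoeff m f *: h m.

Lemma lextEw h (d : {fset M}) f : (msupp f `<=` d)%fset ->
  lext h f = \sum_(m <- d) mcoeff m f *: h m.
Proof.
move=> le; rewrite [LHS](big_fset_incl _ le) => //= x xd /mcoeff_outdom ->.
by rewrite scale0r.
Qed.

Fact lext_linear h : linear (lext h).
Proof.
move=> c f g; set d := (msupp f `|` msupp g)%fset.
have sf : (msupp f `<=` d)%fset by apply: fsubsetUl.
have sg : (msupp g `<=` d)%fset by apply: fsubsetUr.
have sfg : (msupp (c *: f + g) `<=` d)%fset.
  by apply: fsubset_trans (msuppD_le _ _) _; apply: fsetSU; apply: msuppZ_le.
rewrite (lextEw h sf) (lextEw h sg) (lextEw h sfg) scaler_sumr -big_split /=.
by apply: eq_bigr => m _; rewrite mcoeffD mcoeffZ scalerDl scalerA.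
Qed.

HB.instance Definition _ h :=
  GRing.isLinear.Build K {malg K[M]} V *:%R (lext h) (lext_linear h).

Lemma lextU h m : lext h << m >> = h m.
Proof. by rewrite (lextEw h msuppU_le) big_seq_fset1 mcoeffUU scale1r. Qed.

Lemma malgE_scale (f : {malg K[M]}) : f = \sum_(m <- msupp f) mcoeff m f *: << m >>.
Proof.
rewrite {1}[f]monalgE; apply: eq_bigr => m _.
by apply/malgP => k; rewrite mcoeffZ !mcoeffU mulr_natr.
Qed.

End LinearExtension.

Section MonoidAlgebra.
Variables (K : fieldType) (M : monomType).
Implicit Types f g : {malg K[M]}.

Lemma malg_scalerAr c f g : f * (c *: g) = c *: (f * g).
Proof.
have malgC_comm : f * c%:MP = c%:MP * f.
  rewrite !malgM_def fgmulgU fgmulUg; apply: eq_bigr => m _.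
  by rewrite mulm1 mul1m mulrC.
by rewrite -!mul_malgC mulrA malgC_comm mulrA.
Qed.

Lemma monomM (m1 m2 : M) : << m1 >> * << m2 >> = << mmul m1 m2 >> :> {malg K[M]}.
Proof. by rewrite malgM_def fgmulUU mulr1. Qed.

Lemma lextUM (V : lmodType K) (h : M -> V) m f :
  lext h (<< m >> * f) = lext (fun m' => h (mmul m m')) f.
Proof.
rewrite {1}[f]malgE_scale mulr_sumr linear_sum; apply: eq_bigr => m' _ /=.
by rewrite malg_scalerAr monomM linearZ /= lextU.
Qed.

End MonoidAlgebra.

Section FreeAlgebra.
Variables (K : fieldType) (I : choiceType).
Local Notation T := (free_alg K I).

Lemma scaler_free_algAr c (f g : T) : f * (c *: g) = c *: (f * g).
Proof. exact: malg_scalerAr. Qed.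

Lemma free_alg_ind (P : T -> Prop) :
    P 1 -> (forall c f g, P f -> P g -> P (c *: f + g)) ->
    (forall i f, P f -> P (gen K i * f)) ->
  forall f, P f.
Proof.
move=> P1 PD Pg f.
have P0 : P 0 by rewrite -(addNr 1) -scaleN1r; apply: PD.
have Pm (m : {fmonom I}) : P << m >>.
  rewrite -[m]fmK; elim: (m : seq I) => [|i s IH]; first by rewrite -fmoneE.
  have -> : FMonom (i :: s) = mmul (fmu i) (FMonom s) by rewrite [RHS]fmmulE fmuE.
  by rewrite -monomM; apply: Pg.
rewrite [f]malgE_scale; elim/big_rec: _ => [|m g _ Pg']; first exact: P0.
exact: PD.
Qed.

Lemma lext_gen (V : lmodType K) (h : {fmonom I} -> V) i (f : T) :
  lext h (gen K i * f) = lext (fun m => h (mmul (fmu i) m)) f.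
Proof. exact: lextUM. Qed.

End FreeAlgebra.

Section Actions.
Variables (K : fieldType) (A : lalgType K) (V : lmodType K).

Definition action (e : A -> V -> V) : Prop :=
  [/\ forall a, linear (e a),
      forall c a b v, e (c *: a + b) v = c *: e a v + e b v,
      forall v, e 1 v = v
    & forall a b v, e (a * b) v = e a (e b v)].

Lemma action_from_generators (I : Type) (g : I -> A) (s : I -> {linear V -> V})
    (e : A -> V -> V) :
    (forall P : A -> Prop, P 1 -> (forall c a b, P a -> P b -> P (c *: a + b)) ->
       (forall i a, P a -> P (g i * a)) -> forall a, P a) ->
    (forall c a b v, e (c *: a + b) v = c *: e a v + e b v) ->
    (forall v, e 1 v = v) ->
    (forall i a v, e (g i * a) v = s i (e a v)) ->
  action e.
Proof.
move=> ind eP e1 eg; split=> // [a c u v|a b v].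
  elim/ind: a => [|d a b IHa IHb|i a IH]; first by rewrite !e1.
    by rewrite !eP IHa IHb !scalerDr !scalerA mulrC addrACA.
  by rewrite !eg IH linearP.
elim/ind: a => [|c a1 a2 IH1 IH2|i a IH]; first by rewrite mul1r e1.
  by rewrite mulrDl -scalerAl !eP IH1 IH2.
by rewrite -mulrA !eg IH.
Qed.

Variable e : A -> V -> V.
Hypothesis act_e : action e.

Lemma actionD a b v : e (a + b) v = e a v + e b v.
Proof. by have [_ eP _ _] := act_e; rewrite -{1}[a]scale1r eP scale1r. Qed.

Lemma action0 v : e 0 v = 0.
Proof. by apply: (addrI (e 0 v)); rewrite -actionD !addr0. Qed.

Lemma actionZ c a v : e (c *: a) v = c *: e a v.
Proof. by have [_ eP _ _] := act_e; rewrite -[c *: a]addr0 eP action0 addr0. Qed.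

Lemma actionB a b v : e (a - b) v = e a v - e b v.
Proof. by rewrite actionD -[- b]scaleN1r actionZ scaleN1r. Qed.

Lemma action_sum (J : Type) (r : seq J) (P : pred J) (F : J -> A) v :
  e (\sum_(i <- r | P i) F i) v = \sum_(i <- r | P i) e (F i) v.
Proof.
by apply: (big_morph (fun a => e a v) (fun a b => actionD a b v) (action0 v)).
Qed.

Lemma action_linear0 a : e a 0 = 0.
Proof.
have [lin _ _ _] := act_e.
by rewrite -{1}(addNr 0) -scaleN1r lin scaleN1r addNr.
Qed.

Lemma action_linearZ a c v : e a (c *: v) = c *: e a v.
Proof.
by have [lin _ _ _] := act_e; rewrite -[c *: v]addr0 lin action_linear0 addr0.
Qed.

Variable S : A -> Prop.
Hypothesis eS : forall z, S z -> forall v, e z v = 0.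

Lemma action_ideal z v : ideal S z -> e z v = 0.
Proof.
have [_ _ _ eM] := act_e => Iz.
elim: Iz v => [a /eS Sa v //|v|a b _ IHa _ IHb v|a b _ IH v|a b _ IH v].
- exact: action0.
- by rewrite actionD IHa IHb addr0.
- by rewrite eM IH action_linear0.
- by rewrite eM IH.
Qed.

Definition quot_act (x : quot S) (v : V) : V := e (repr x) v.

Lemma quot_act_cls a v : quot_act (cls S a) v = e a v.
Proof. by apply/eqP; rewrite -subr_eq0 -actionB (action_ideal _ (repr_cls S a)). Qed.

End Actions.

Section QuotientMorphism.
Variables (K : fieldType) (A : lalgType K) (S : A -> Prop).

Fact cls_linear : linear (cls S).
Proof.
move=> c a b; rewrite -[RHS]/(quot_add (quot_scale c (cls S a)) (cls S b)).
by rewrite cls_scale cls_add.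
Qed.
HB.instance Definition _ := GRing.isLinear.Build K A (quot S) *:%R (cls S) cls_linear.

Lemma clsM a b : cls S (a * b) = cls S a * cls S b.
Proof. by rewrite -[RHS]/(quot_mul _ _) cls_mul. Qed.

Lemma cls1 : cls S 1 = 1. Proof. by []. Qed.

Lemma cls_ideal a : ideal S a -> cls S a = 0.
Proof.
by move=> Sa; rewrite -(linear0 (cls S)); apply/eq_cls; rewrite subr0.
Qed.

End QuotientMorphism.

Lemma quot_act_representation (K : fieldType) (A : lalgType K) (V : lmodType K)
    (e : A -> V -> V) (S : A -> Prop) :
  action e -> (forall z, S z -> forall v, e z v = 0) ->
  representation (@quot_act K A V e S).
Proof.
move=> act_e eS; have [lin eP e1 eM] := act_e; split=> [a|c a b f|f|a b f].
- exact: lin.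
- by rewrite -[a]cls_reprK -[b]cls_reprK -linearP !quot_act_cls // eP.
- by rewrite -cls1 quot_act_cls // e1.
- by rewrite -[a]cls_reprK -[b]cls_reprK -clsM !quot_act_cls // eM.
Qed.

Section Evaluation.
Variables (K : fieldType) (I : choiceType) (V : lmodType K).
Variable s : I -> {linear V -> V}.

Definition ev (f : free_alg K I) (v : V) : V :=
  lext (fun m : {fmonom I} => foldr (fun i => s i) v m) f.

Lemma ev_genM i f v : ev (gen K i * f) v = s i (ev f v).
Proof.
rewrite /ev lext_gen /lext linear_sum; apply: eq_bigr => m _.
by rewrite linearZ /= fmM fmU.
Qed.

Lemma ev_action : action ev.
Proof.
apply: (@action_from_generators _ _ _ I (@gen K I) s).
- exact: free_alg_ind.
- by move=> c a b v; apply: lext_linear.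
- by move=> v; rewrite /ev [lext _ _]lextU fm1.
- exact: ev_genM.
Qed.

Lemma ev_gen i v : ev (gen K i) v = s i v.
Proof. by have [_ _ e1 _] := ev_action; rewrite -[gen K i]mulr1 ev_genM e1. Qed.

End Evaluation.

(** * Index identities for Hecke symmetries *)

Section Sums.

Lemma sum_mxtens (V : nmodType) m n (F : 'I_(m * n) -> V) :
  \sum_x F x = \sum_i \sum_j F (mxtens_index (i, j)).
Proof.
rewrite pair_big (reindex (@mxtens_index m n)) /=.
  by apply: eq_bigr => -[i j].
by exists (@mxtens_unindex m n) => x _; [apply: mxtens_indexK | apply: mxtens_unindexK].
Qed.

Lemma sum_rot3 (V : nmodType) (I1 I2 I3 : finType) (F : I1 -> I2 -> I3 -> V) :
  \sum_a \sum_b \sum_c F a b c = \sum_c \sum_a \sum_b F a b c.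
Proof. by rewrite [RHS]exchange_big; apply: eq_bigr => a _; rewrite exchange_big. Qed.

Lemma sum_rot4 (V : nmodType) (I1 I2 I3 I4 : finType) (F : I1 -> I2 -> I3 -> I4 -> V) :
  \sum_a \sum_b \sum_c \sum_d F a b c d = \sum_d \sum_a \sum_b \sum_c F a b c d.
Proof. by rewrite [RHS]exchange_big; apply: eq_bigr => a _; rewrite sum_rot3. Qed.

Lemma sum_deltaZ (K : pzRingType) (V : lmodType K) (I : finType) (j : I) (F : I -> V) :
  \sum_i (i == j)%:R *: F i = F j.
Proof.
rewrite (bigD1 j) //= eqxx scale1r big1 ?addr0 // => i /negbTE ->.
by rewrite scale0r.
Qed.

Lemma sum_delta (K : pzRingType) (I : finType) (j : I) (F : I -> K) :
  \sum_i (i == j)%:R * F i = F j.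
Proof. exact: (@sum_deltaZ K K^o). Qed.

End Sums.

Section Entries.
Variables (K : fieldType) (N : nat).
Implicit Types A B C : 'M[K]_(N * N).

Lemma entryM A B i j k l :
  entry (A *m B) i j k l = \sum_a \sum_b entry A i j a b * entry B a b k l.
Proof. by rewrite /entry mxE sum_mxtens. Qed.

Lemma entryD A B i j k l : entry (A + B) i j k l = entry A i j k l + entry B i j k l.
Proof. by rewrite /entry mxE. Qed.

Lemma entry_scalar c (i j k l : 'I_N) :
  entry c%:M i j k l = (i == k)%:R * (j == l)%:R * c :> K.
Proof.
rewrite /entry !mxE (inj_eq (can_inj (@mxtens_indexK N N))) xpair_eqE.
by rewrite -natrM mulnb mulr_natl.
Qed.

Lemma sum_entry_scalarl c i j (F : 'I_N -> 'I_N -> K) :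
  \sum_a \sum_b entry c%:M i j a b * F a b = c * F i j.
Proof.
rewrite -(sum_delta i (fun a => c * F a j)); apply: eq_bigr => a _.
rewrite -(sum_delta j (fun b => (a == i)%:R * (c * F a b))); apply: eq_bigr => b _.
rewrite entry_scalar [i == a]eq_sym [j == b]eq_sym -!mulrA.
by rewrite [LHS]mulrCA.
Qed.

Lemma sum_entry_scalarr c k l (F : 'I_N -> 'I_N -> K) :
  \sum_a \sum_b F a b * entry c%:M a b k l = c * F k l.
Proof.
rewrite -sum_entry_scalarl; apply: eq_bigr => a _; apply: eq_bigr => b _.
by rewrite !entry_scalar [k == a]eq_sym [l == b]eq_sym mulrC.
Qed.

Local Notation idx3 i j k := (mxtens_index (mxtens_index (i, j), k)).

Lemma R12E A (i j k i' j' k' : 'I_N) :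
  R12 A (idx3 i j k) (idx3 i' j' k') = entry A i j i' j' * (k == k')%:R.
Proof. by rewrite /R12 tensmxE mxE. Qed.

Lemma R23E A (i j k i' j' k' : 'I_N) :
  R23 A (idx3 i j k) (idx3 i' j' k') = (i == i')%:R * entry A j k j' k'.
Proof.
have cast a b c : cast_ord (esym (mulnA N N N)) (idx3 a b c)
    = mxtens_index (a, mxtens_index (b, c)).
  by apply: val_inj; rewrite /= mulnDl mulnA addnA.
by rewrite /R23 castmxE !cast tensmxE mxE.
Qed.

Lemma mul_R12 A (M : 'M_(N * N * N)) i j k y :
  (R12 A *m M) (idx3 i j k) y = \sum_a \sum_b entry A i j a b * M (idx3 a b k) y.
Proof.
rewrite mxE sum_mxtens sum_mxtens; apply: eq_bigr => a _; apply: eq_bigr => b _.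
rewrite (bigD1 k) //= big1 ?addr0 => [|c ck]; rewrite R12E.
  by rewrite eqxx mulr1.
by rewrite eq_sym (negbTE ck) mulr0 mul0r.
Qed.

Lemma mul_R23 A (M : 'M_(N * N * N)) i j k y :
  (R23 A *m M) (idx3 i j k) y = \sum_a \sum_b entry A j k a b * M (idx3 i a b) y.
Proof.
rewrite mxE sum_mxtens sum_mxtens (bigD1 i) //= [X in _ + X]big1 ?addr0 => [|c ci].
  by apply: eq_bigr => a _; apply: eq_bigr => b _; rewrite R23E eqxx mul1r.
apply: big1 => a _; apply: big1 => b _.
by rewrite R23E eq_sym (negbTE ci) !mul0r.
Qed.

Lemma braid_entries A B C A' B' C' :
    R12 A *m R23 B *m R12 C = R23 A' *m R12 B' *m R23 C' ->
  forall i j k i' j' k',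
    \sum_a \sum_b \sum_c entry A i j a b * entry B b k c k' * entry C a c i' j'
    = \sum_a \sum_b \sum_c entry A' j k a b * entry B' i a i' c * entry C' c b j' k'.
Proof.
move=> eqABC i j k i' j' k'.
have := congr1 (fun M : 'M_(N * N * N) => M (idx3 i j k) (idx3 i' j' k')) eqABC.
rewrite -!mulmxA mul_R12 mul_R23 => eqE; transitivity (\sum_a \sum_b
    entry A i j a b * (R23 B *m R12 C) (idx3 a b k) (idx3 i' j' k')).
  apply: eq_bigr => a _; apply: eq_bigr => b _; rewrite mul_R23 mulr_sumr.
  apply: eq_bigr => c _; rewrite -mulrA; congr (_ * _).
  rewrite -(sum_delta k' (fun d => entry B b k c d * entry C a c i' j')).
  by apply: eq_bigr => d _; rewrite R12E [RHS]mulrA [RHS]mulrC.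
rewrite {}eqE; apply: eq_bigr => a _; apply: eq_bigr => b _; rewrite mul_R12.
rewrite exchange_big mulr_sumr; apply: eq_bigr => c _; rewrite -mulrA; congr (_ * _).
rewrite -(sum_delta i' (fun d => entry B' i a d c * entry C' c b j' k')).
by apply: eq_bigr => d _; rewrite R23E mulrCA.
Qed.

Lemma R12M A B : R12 A *m R12 B = R12 (A *m B).
Proof. by rewrite /R12 tensmx_mul mulmx1. Qed.

Lemma R23M A B : R23 A *m R23 B = R23 (A *m B).
Proof.
rewrite /R23; case: _ / (mulnA N N N).
by rewrite !castmx_id tensmx_mul mulmx1.
Qed.

Lemma R12_1 : R12 1%:M = 1%:M :> 'M[K]_(N * N * N).
Proof.
apply/matrixP => x y; case: (mxtens_indexP x) (mxtens_indexP y) => u k [v k'].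
rewrite tensmxE !mxE (inj_eq (can_inj (@mxtens_indexK _ _))) xpair_eqE.
by rewrite -natrM mulnb.
Qed.

Lemma R23_1 : R23 1%:M = 1%:M :> 'M[K]_(N * N * N).
Proof.
rewrite /R23; case: _ / (mulnA N N N); rewrite castmx_id.
apply/matrixP => x y; case: (mxtens_indexP x) (mxtens_indexP y) => u k [v k'].
rewrite tensmxE !mxE (inj_eq (can_inj (@mxtens_indexK _ _))) xpair_eqE.
by rewrite -natrM mulnb.
Qed.

End Entries.

Section BraidInverses.
Variables (K : fieldType) (n : nat) (a b a' b' : 'M[K]_n).
Hypotheses (aa' : a *m a' = 1%:M) (bb' : b *m b' = 1%:M).
Hypothesis aba : a *m b *m a = b *m a *m b.

Let a'a : a' *m a = 1%:M := mulmx1C aa'.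
Let b'b : b' *m b = 1%:M := mulmx1C bb'.

Lemma braid_aba' : a *m b *m a' = b' *m a *m b.
Proof.
transitivity (b' *m (b *m a *m b) *m a'); first by rewrite !mulmxA b'b mul1mx.
by rewrite -aba -!mulmxA aa' mulmx1.
Qed.

Lemma braid_a'ba : a' *m b *m a = b *m a *m b'.
Proof.
transitivity (a' *m (b *m a *m b) *m b'); first by rewrite -!mulmxA bb' mulmx1.
by rewrite -aba !mulmxA a'a mul1mx.
Qed.

Lemma braid_ab'a' : a *m b' *m a' = b' *m a' *m b.
Proof.
have XZ : (a *m b' *m a') *m (a *m b *m a') = 1%:M.
  by rewrite !mulmxA -[_ *m a' *m a]mulmxA a'a mulmx1 -[_ *m b' *m b]mulmxA b'b mulmx1.
have YZ : (b' *m a' *m b) *m (a *m b *m a') = 1%:M.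
  rewrite braid_aba' !mulmxA -[_ *m b *m b']mulmxA bb' mulmx1.
  by rewrite -[_ *m a' *m a]mulmxA a'a mulmx1.
by rewrite -[LHS]mulmx1 -(mulmx1C YZ) mulmxA XZ mul1mx.
Qed.

Lemma braid_a'b'a : a' *m b' *m a = b *m a' *m b'.
Proof.
have XZ : (a' *m b' *m a) *m (a' *m b *m a) = 1%:M.
  by rewrite !mulmxA -[_ *m a *m a']mulmxA aa' mulmx1 -[_ *m b' *m b]mulmxA b'b mulmx1.
have YZ : (b *m a' *m b') *m (a' *m b *m a) = 1%:M.
  rewrite braid_a'ba !mulmxA -[_ *m b' *m b]mulmxA b'b mulmx1.
  by rewrite -[_ *m a' *m a]mulmxA a'a mulmx1.
by rewrite -[LHS]mulmx1 -(mulmx1C YZ) mulmxA XZ mul1mx.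
Qed.

End BraidInverses.

Section SkewInverse.
Variables (K : fieldType) (N : nat) (R Psi : 'M[K]_(N * N)).
Hypothesis RPsi : skew_inverse R Psi.

Local Notation r := (entry R).
Local Notation psi := (entry Psi).
Local Notation B := (Bmx Psi).

Lemma BmxE i j : B i j = \sum_k psi k i k j.
Proof. by rewrite mxE. Qed.

(* The contraction defining Psi is a product of N^2 x N^2 matrices once the
   index pairs are regrouped, so that it holds in the other order as well. *)
Lemma skew_inverseC j l a c :
  \sum_i \sum_k psi l k j i * r i a k c = (j == a)%:R * (l == c)%:R.
Proof.
pose u (x : 'I_(N * N)) := mxtens_unindex x.
pose A := \matrix_(x, y) r (u x).1 (u y).1 (u x).2 (u y).2.
pose P := \matrix_(x, y) psi (u x).2 (u y).2 (u x).1 (u y).1.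
have AP : A *m P = 1%:M.
  apply/matrixP => x y; case: (mxtens_indexP x) (mxtens_indexP y) => i k [s p].
  rewrite !mxE sum_mxtens (inj_eq (can_inj (@mxtens_indexK N N))) xpair_eqE.
  rewrite -mulnb natrM [k == p]eq_sym -RPsi.
  by apply: eq_bigr => b _; apply: eq_bigr => d _; rewrite !mxE /u !mxtens_indexK.
have /matrixP/(_ (mxtens_index (j, l)) (mxtens_index (a, c))) := mulmx1C AP.
rewrite !mxE sum_mxtens (inj_eq (can_inj (@mxtens_indexK N N))) xpair_eqE.
rewrite -mulnb natrM => <-.
by apply: eq_bigr => i _; apply: eq_bigr => k _; rewrite !mxE /u !mxtens_indexK.
Qed.

Lemma traceB a c : \sum_i \sum_k B k i * r i a k c = (a == c)%:R.
Proof.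
under eq_bigr do under eq_bigr do rewrite BmxE mulr_suml.
rewrite sum_rot3; under eq_bigr do rewrite skew_inverseC.
by rewrite sum_delta eq_sym.
Qed.

Lemma skew_strip (F : 'I_N -> 'I_N -> K) p s :
  \sum_j \sum_l (\sum_i \sum_k F i k * r i j k l) * psi l p j s = F s p.
Proof.
transitivity (\sum_i \sum_k F i k * ((i == s)%:R * (p == k)%:R)).
  under [RHS]eq_bigr do under eq_bigr do rewrite -RPsi mulr_sumr.
  rewrite [RHS]sum_rot3; apply: eq_bigr => j _.
  under [RHS]eq_bigr do under eq_bigr do rewrite mulr_sumr.
  rewrite [RHS]sum_rot3; apply: eq_bigr => l _; rewrite mulr_suml.
  apply: eq_bigr => i _; rewrite mulr_suml; apply: eq_bigr => k _.
  by rewrite mulrA.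
rewrite -(sum_delta s (fun i => F i p)); apply: eq_bigr => i _.
rewrite -(sum_delta p (fun k => (i == s)%:R * F i k)); apply: eq_bigr => k _.
by rewrite [p == k]eq_sym [LHS]mulrC [X in X * _ = _]mulrC -mulrA.
Qed.

(* Contraction of the braid relation in its first space with B; by the skew
   inverse the remaining factor R can be cancelled. *)
Lemma traceB_conj A C : A *m C = 1%:M -> C *m A = 1%:M ->
    R12 A *m R23 R *m R12 C = R23 C *m R12 R *m R23 A ->
  forall j p s j',
    \sum_i \sum_i' \sum_a B i' i * entry A i j a s * entry C a p i' j'
    = (j == j')%:R * B p s.
Proof.
move=> AC CA /braid_entries braid j p s j'.
pose T c b := \sum_i \sum_i' \sum_a B i' i * entry A i j a b * entry C a c i' j'.
have Tr k k' : \sum_b \sum_c T c b * r b k c k' = (j == j')%:R * (k == k')%:R.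
  transitivity (\sum_i \sum_i' B i' i *
      \sum_a \sum_b \sum_c entry A i j a b * r b k c k' * entry C a c i' j').
    under eq_bigr do under eq_bigr do rewrite /T !mulr_suml.
    rewrite sum_rot3; apply: eq_bigr => i _.
    under eq_bigr do under eq_bigr do rewrite !mulr_suml.
    rewrite sum_rot3; apply: eq_bigr => i' _.
    under eq_bigr do under eq_bigr do rewrite !mulr_suml.
    rewrite sum_rot3 mulr_sumr; apply: eq_bigr => a _.
    rewrite mulr_sumr; apply: eq_bigr => b _.
    rewrite mulr_sumr; apply: eq_bigr => c _.
    by rewrite -!mulrA [X in _ * (_ * X)]mulrC.
  under eq_bigr do under eq_bigr do rewrite braid.
  transitivity (\sum_a \sum_b \sum_c entry C j k a b * (a == c)%:R * entry A c b j' k').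
    under [RHS]eq_bigr do under eq_bigr do under eq_bigr do
      rewrite -traceB mulr_sumr mulr_suml.
    rewrite [LHS](_ : _ = \sum_i \sum_i' \sum_a \sum_b \sum_c
       B i' i * (entry C j k a b * r i a i' c * entry A c b j' k')).
      transitivity (\sum_a \sum_i \sum_i' \sum_b \sum_c
        B i' i * (entry C j k a b * r i a i' c * entry A c b j' k')).
        by rewrite sum_rot3.
      apply: eq_bigr => a _.
      transitivity (\sum_b \sum_i \sum_i' \sum_c
        B i' i * (entry C j k a b * r i a i' c * entry A c b j' k')).
        by rewrite sum_rot3.
      apply: eq_bigr => b _; rewrite sum_rot3; apply: eq_bigr => c _.
      apply: eq_bigr => i _; rewrite mulr_sumr mulr_suml; apply: eq_bigr => i' _.
      by rewrite !mulrA [B i' i * _]mulrC.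
    apply: eq_bigr => i _; apply: eq_bigr => i' _; rewrite mulr_sumr.
    apply: eq_bigr => a _; rewrite mulr_sumr.
    by apply: eq_bigr => b _; rewrite mulr_sumr.
  transitivity (entry (C *m A) j k j' k'); last by rewrite CA entry_scalar mulr1.
  rewrite entryM; apply: eq_bigr => a _; apply: eq_bigr => b _.
  rewrite -(sum_delta a (fun c => entry C j k a b * entry A c b j' k')).
  by apply: eq_bigr => c _; rewrite [a == c]eq_sym mulrCA mulrA.
rewrite -[LHS]/(T p s) -(skew_strip (fun b c => T c b)).
rewrite BmxE mulr_sumr; apply: eq_bigr => k _.
rewrite -(sum_delta k (fun k' => (j == j')%:R * psi k' p k s)).
by apply: eq_bigr => k' _; rewrite Tr [k == k']eq_sym mulrCA mulrA.
Qed.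

Variables (Rinv : 'M[K]_(N * N)) (D : K).
Hypothesis RRinv : R *m Rinv = 1%:M.
Hypothesis R_Rinv : R = Rinv + D%:M.
Hypothesis YB : R12 R *m R23 R *m R12 R = R23 R *m R12 R *m R23 R.

Local Notation ri := (entry Rinv).

Let RinvR : Rinv *m R = 1%:M := mulmx1C RRinv.
Let R12V : R12 R *m R12 Rinv = 1%:M.
Proof. by rewrite R12M RRinv R12_1. Qed.
Let R23V : R23 R *m R23 Rinv = 1%:M.
Proof. by rewrite R23M RRinv R23_1. Qed.

Lemma braid_R_Rinv_Rinv i j k i' j' k' :
  \sum_a \sum_b \sum_c r i j a b * ri b k c k' * ri a c i' j'
  = \sum_a \sum_b \sum_c ri j k a b * ri i a i' c * r c b j' k'.
Proof. by apply: braid_entries; apply: braid_ab'a'. Qed.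

Lemma braid_Rinv_Rinv_R i j k i' j' k' :
  \sum_a \sum_b \sum_c ri i j a b * ri b k c k' * r a c i' j'
  = \sum_a \sum_b \sum_c r j k a b * ri i a i' c * ri c b j' k'.
Proof. by apply: braid_entries; apply: braid_a'b'a. Qed.

Lemma traceB_R_Rinv j p s j' :
  \sum_i \sum_i' \sum_a B i' i * r i j a s * ri a p i' j' = (j == j')%:R * B p s.
Proof. by apply: traceB_conj => //; apply: braid_aba'. Qed.

Let traceB_Rinv_R j p s j' :
  \sum_i \sum_i' \sum_a B i' i * ri i j a s * r a p i' j' = (j == j')%:R * B p s.
Proof. by apply: traceB_conj => //; apply: braid_a'ba. Qed.

Let Rinv_B_left p n m s :
  \sum_c ri p n c m * B c s = \sum_l psi l p m s * B n l.
Proof.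
transitivity (\sum_i' B i' s * ri p n i' m).
  by apply: eq_bigr => c _; rewrite mulrC.
rewrite -(skew_strip (fun i b => \sum_i' B i' i * ri b n i' m)).
rewrite -(sum_delta m (fun j => \sum_l psi l p j s * B n l)).
apply: eq_bigr => j _; rewrite mulr_sumr; apply: eq_bigr => l _.
rewrite [RHS]mulrCA [RHS]mulrC -traceB_R_Rinv; congr (_ * _).
apply: eq_bigr => i _; rewrite exchange_big; apply: eq_bigr => k _.
by rewrite mulr_suml; apply: eq_bigr => i' _; rewrite mulrAC.
Qed.

Let B_left_Rinv p j s b :
  \sum_i B p i * ri i j s b = \sum_c psi j p c s * B c b.
Proof.
rewrite -(skew_strip (fun a i' => \sum_i B i' i * ri i j a b)).
apply: eq_bigr => c _.
rewrite -(sum_delta j (fun j' => psi j' p c s * B c b)); apply: eq_bigr => j' _.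
rewrite [j' == j]eq_sym [RHS]mulrCA [RHS]mulrC -traceB_Rinv_R; congr (_ * _).
rewrite sum_rot3; apply: eq_bigr => a _; rewrite exchange_big.
by apply: eq_bigr => i' _; rewrite mulr_suml.
Qed.

Lemma BB_Rinv d n k l :
  \sum_a \sum_b B d a * B n b * ri a b k l
  = \sum_a \sum_b ri d n a b * (B a k * B b l).
Proof.
transitivity (\sum_b \sum_c psi b d c k * B n b * B c l).
  rewrite exchange_big; apply: eq_bigr => b _; rewrite -[RHS]/(\sum_c _).
  transitivity (B n b * \sum_a B d a * ri a b k l).
    by rewrite mulr_sumr; apply: eq_bigr => a _; rewrite mulrAC mulrC.
  rewrite B_left_Rinv mulr_sumr; apply: eq_bigr => c _.
  by rewrite mulrA [B n b * _]mulrC.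
rewrite exchange_big [RHS]exchange_big; apply: eq_bigr => c _ /=.
rewrite -mulr_suml -Rinv_B_left mulr_suml; apply: eq_bigr => e _.
by rewrite mulrA.
Qed.

Lemma BB_R d n k l :
  \sum_a \sum_b B d a * B n b * r a b k l
  = \sum_a \sum_b r d n a b * (B a k * B b l).
Proof.
rewrite R_Rinv.
under eq_bigr do under eq_bigr do rewrite entryD mulrDr.
under [RHS]eq_bigr do under eq_bigr do rewrite entryD mulrDl.
under eq_bigr do rewrite big_split; under [RHS]eq_bigr do rewrite big_split.
by rewrite !big_split /= BB_Rinv sum_entry_scalarr sum_entry_scalarl.
Qed.

End SkewInverse.

(** * Twisted derivations *)

Lemma scaler_swap (K : comPzRingType) (V : lmodType K) c d (v : V) :
  c *: (d *: v) = d *: (c *: v).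
Proof. by rewrite !scalerA mulrC. Qed.

Lemma ffun_lincomb (K : pzRingType) (V : lmodType K) (I : finType) c
  (u v : {ffun I -> V}) i : (c *: u + v) i = c *: u i + v i.
Proof. by rewrite !ffunE. Qed.

Section FockOperators.
Variables (K : fieldType) (N : nat) (q : K) (R Rinv : 'M[K]_(N * N)).
Hypothesis q0 : q != 0.
Hypothesis RRinv : R *m Rinv = 1%:M.
Hypothesis R_Rinv : R = Rinv + (q - q^-1)%:M.
Hypothesis YB : R12 R *m R23 R *m R12 R = R23 R *m R12 R *m R23 R.

Local Notation r := (entry R).
Local Notation ri := (entry Rinv).

Variables (V : lmodType K) (X : 'I_N -> {linear V -> V}).
Hypothesis XX : forall i j v,
  q *: X i (X j v) = \sum_a \sum_b r i j a b *: X a (X b v).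

Local Notation W := {ffun option 'I_N -> V}.

Definition shift (j : 'I_N) (w : W) : W :=
  [ffun o => if o is Some i then
      (i == j)%:R *: w None + q^-1 *: \sum_l \sum_k ri j l i k *: X k (w (Some l))
    else X j (w None)].

Lemma shift_Some j (w : W) (v : V) (d : 'I_N -> V) i :
  w None = v -> (forall l, w (Some l) = d l) ->
  shift j w (Some i)
  = (i == j)%:R *: v + q^-1 *: \sum_l \sum_k ri j l i k *: X k (d l).
Proof.
move=> <- wd; rewrite ffunE; under eq_bigr do under eq_bigr do rewrite wd.
by [].
Qed.

Lemma shift_None j w : shift j w None = X j (w None).
Proof. by rewrite ffunE. Qed.

Fact shift_linear j : linear (shift j).
Proof.
move=> c u v; apply/ffunP => -[i|]; rewrite !ffunE; last exact: linearP.
rewrite !scalerDr !scalerA [_ * c]mulrC addrACA; congr (_ + _).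
rewrite [c * _]mulrC -scalerA -scalerDr; congr (_ *: _).
rewrite scaler_sumr -big_split; apply: eq_bigr => l _ /=.
rewrite scaler_sumr -big_split; apply: eq_bigr => k _ /=.
by rewrite !ffunE linearP scalerDr !scalerA mulrC.
Qed.

HB.instance Definition _ j := GRing.isLinear.Build K W W *:%R (shift j) (shift_linear j).

Lemma shift2E a b (w : W) i :
  shift a (shift b w) (Some i)
  = (i == a)%:R *: X b (w None) + q^-1 *: \sum_k ri a b i k *: X k (w None)
    + q^-1 *: (q^-1 *: \sum_n \sum_l \sum_m \sum_k
        (ri b n l m * ri a l i k) *: X k (X m (w (Some n)))).
Proof.
rewrite [LHS]ffunE [in LHS]ffunE -addrA -scalerDr; congr (_ + _ *: _).
under eq_bigr do under eq_bigr do
  rewrite ffunE linearD linearZ scalerDr scalerA mulrC -scalerA.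
under eq_bigr do rewrite big_split /= -scaler_sumr.
rewrite big_split /= sum_deltaZ; congr (_ + _).
rewrite [in RHS]exchange_big scaler_sumr; apply: eq_bigr => l _ /=.
under eq_bigr do rewrite linearZ scalerA mulrC -scalerA.
rewrite -scaler_sumr; congr (_ *: _).
under [LHS]eq_bigr do rewrite linear_sum scaler_sumr.
rewrite [LHS]exchange_big; apply: eq_bigr => n _ /=.
under [LHS]eq_bigr do rewrite linear_sum scaler_sumr.
rewrite exchange_big; apply: eq_bigr => m _ /=.
by apply: eq_bigr => k _; rewrite linearZ scalerA mulrC.
Qed.

Lemma shift_sym_rel a b w :
  q *: shift a (shift b w) = \sum_c \sum_d r a b c d *: shift c (shift d w).
Proof.
apply/ffunP => o; rewrite ffunE sum_ffunE.
under [RHS]eq_bigr do rewrite sum_ffunE.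
under [RHS]eq_bigr do under eq_bigr do rewrite ffunE.
case: o => [i|]; last first.
  rewrite !ffunE XX; apply: eq_bigr => c _; apply: eq_bigr => d _.
  by rewrite !ffunE.
under [RHS]eq_bigr do under eq_bigr do rewrite shift2E !scalerDr.
under [RHS]eq_bigr do rewrite !big_split /=.
rewrite shift2E !big_split /= !scalerDr; congr (_ + _).
  have -> : \sum_c \sum_d r a b c d *: ((i == c)%:R *: X d (w None))
      = \sum_k ri a b i k *: X k (w None) + ((q - q^-1) * (i == a)%:R) *: X b (w None).
    rewrite -(sum_deltaZ b (fun d => ((q - q^-1) * (i == a)%:R) *: X d (w None))).
    rewrite -big_split exchange_big; apply: eq_bigr => d _ /=.
    transitivity (r a b i d *: X d (w None)).
      rewrite -(sum_deltaZ i (fun c => r a b c d *: X d (w None))).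
      by apply: eq_bigr => c _; rewrite !scalerA [c == i]eq_sym mulrC.
    rewrite scalerA -scalerDl R_Rinv entryD entry_scalar.
    by rewrite [a == i]eq_sym [b == d]eq_sym -mulrA mulrC -mulrA mulrCA.
  have -> : \sum_c \sum_d r a b c d *: (q^-1 *: \sum_k ri c d i k *: X k (w None))
      = (q^-1 * (i == a)%:R) *: X b (w None).
    rewrite -(sum_deltaZ b (fun k => (q^-1 * (i == a)%:R) *: X k (w None))).
    transitivity (\sum_k (q^-1 * entry (R *m Rinv) a b i k) *: X k (w None)).
      under [RHS]eq_bigr do rewrite entryM mulr_sumr scaler_suml.
      rewrite [RHS]exchange_big; apply: eq_bigr => c _ /=.
      under [RHS]eq_bigr do rewrite mulr_sumr scaler_suml.
      rewrite [RHS]exchange_big; apply: eq_bigr => d _ /=.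
      rewrite !scaler_sumr; apply: eq_bigr => k _.
      by rewrite !scalerA -mulrA mulrCA.
    apply: eq_bigr => k _; rewrite RRinv entry_scalar mulr1 scalerA.
    by rewrite [a == i]eq_sym [b == k]eq_sym mulrA mulrC.
  rewrite !scalerA divff // scale1r -[RHS]addrA [LHS]addrC; congr (_ + _).
  by rewrite -scalerDl -mulrDl subrK.
transitivity (q^-1 *: (q^-1 *: \sum_n \sum_l \sum_m \sum_k
    (ri b n l m * ri a l i k) *: (q *: X k (X m (w (Some n)))))).
  rewrite [LHS]scaler_swap; congr (_ *: _); rewrite [LHS]scaler_swap; congr (_ *: _).
  rewrite scaler_sumr; apply: eq_bigr => n _; rewrite scaler_sumr.
  apply: eq_bigr => l _; rewrite scaler_sumr; apply: eq_bigr => m _.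
  by rewrite scaler_sumr; apply: eq_bigr => k _; rewrite !scalerA mulrC.
under [RHS]eq_bigr do under eq_bigr do rewrite scaler_swap.
under [RHS]eq_bigr do rewrite -scaler_sumr.
rewrite -scaler_sumr; congr (_ *: _).
under [RHS]eq_bigr do under eq_bigr do rewrite scaler_swap.
under [RHS]eq_bigr do rewrite -scaler_sumr.
rewrite -scaler_sumr; congr (_ *: _).
under [RHS]eq_bigr do under eq_bigr do rewrite scaler_sumr.
rewrite [RHS]sum_rot3; apply: eq_bigr => n _.
transitivity (\sum_k \sum_m (\sum_x \sum_y \sum_z
    ri b n x y * ri a x i z * r z y k m) *: X k (X m (w (Some n)))).
  transitivity (\sum_x \sum_y \sum_z \sum_k \sum_m
      (ri b n x y * ri a x i z * r z y k m) *: X k (X m (w (Some n)))).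
    apply: eq_bigr => x _; apply: eq_bigr => y _; apply: eq_bigr => z _.
    rewrite XX scaler_sumr; apply: eq_bigr => k _; rewrite scaler_sumr.
    by apply: eq_bigr => m _; rewrite scalerA.
  rewrite [LHS]sum_rot4; apply: eq_bigr => k _.
  rewrite [LHS]sum_rot4; apply: eq_bigr => m _.
  rewrite scaler_suml; apply: eq_bigr => x _; rewrite scaler_suml.
  by apply: eq_bigr => y _; rewrite scaler_suml.
under eq_bigr do under eq_bigr do rewrite -(braid_R_Rinv_Rinv RRinv YB).
under [RHS]eq_bigr do under eq_bigr do rewrite scaler_sumr.
transitivity (\sum_c \sum_d \sum_l \sum_k \sum_m
  (r a b c d * ri d n l m * ri c l i k) *: X k (X m (w (Some n)))).
  rewrite [RHS](_ : _ = \sum_k \sum_c \sum_d \sum_l \sum_m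
      (r a b c d * ri d n l m * ri c l i k) *: X k (X m (w (Some n)))); last first.
    by rewrite sum_rot4.
  apply: eq_bigr => k _; rewrite [RHS]sum_rot4; apply: eq_bigr => m _.
  rewrite scaler_suml; apply: eq_bigr => c _; rewrite scaler_suml.
  by apply: eq_bigr => d _; rewrite scaler_suml.
apply: eq_bigr => c _; apply: eq_bigr => d _; apply: eq_bigr => l _.
rewrite exchange_big scaler_sumr; apply: eq_bigr => m _; rewrite scaler_sumr.
by apply: eq_bigr => k _; rewrite scalerA mulrA.
Qed.


Variable D : 'I_N -> {linear V -> V}.
Hypothesis DX : forall i j v,
  D i (X j v) = (i == j)%:R *: v + q^-1 *: \sum_l \sum_k ri j l i k *: X k (D l v).
Variable vac : V.
Hypothesis Dvac : forall i, D i vac = 0.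
Hypothesis vac_ind : forall P : V -> Prop, P vac ->
  (forall c u v, P u -> P v -> P (c *: u + v)) -> (forall i v, P v -> P (X i v)) ->
  forall v, P v.

Let DDX i j a v :
  D i (D j (X a v))
  = (j == a)%:R *: D i v + q^-1 *: \sum_l ri a l j i *: D l v
    + q^-1 *: (q^-1 *: \sum_l \sum_k \sum_n \sum_m
        (ri a l j k * ri k n i m) *: X m (D n (D l v))).
Proof.
rewrite DX linearD !linearZ -addrA -scalerDr /=; congr (_ + _ *: _).
rewrite linear_sum; under [LHS]eq_bigr do rewrite linear_sum.
under [LHS]eq_bigr do under eq_bigr do
  rewrite linearZ /= DX scalerDr scalerA mulrC -scalerA.
under [LHS]eq_bigr do rewrite big_split /=; rewrite [LHS]big_split /=; congr (_ + _).
  apply: eq_bigr => l _; under [LHS]eq_bigr do rewrite [i == _]eq_sym.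
  by rewrite sum_deltaZ.
rewrite scaler_sumr; apply: eq_bigr => l _; rewrite scaler_sumr.
apply: eq_bigr => k _; rewrite scaler_swap; congr (_ *: _).
rewrite scaler_sumr; apply: eq_bigr => n _; rewrite scaler_sumr.
by apply: eq_bigr => m _; rewrite scalerA.
Qed.

Lemma DD i j v : q *: D i (D j v) = \sum_k \sum_l r l k j i *: D k (D l v).
Proof.
elim/vac_ind: v i j => [|c u v IHu IHv|a v IH] i j.
- rewrite !Dvac linear0 scaler0 big1 // => k _; rewrite big1 // => l _.
  by rewrite Dvac linear0 scaler0.
- rewrite [D j _]linearP [D i _]linearP /= scalerDr scaler_swap IHu IHv.
  rewrite scaler_sumr -big_split; apply: eq_bigr => k _ /=.
  rewrite scaler_sumr -big_split; apply: eq_bigr => l _ /=.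
  by rewrite [D l (_ + _)]linearP [D k (_ + _)]linearP /= scalerDr scaler_swap.
under [RHS]eq_bigr do under eq_bigr do rewrite DDX !scalerDr.
under [RHS]eq_bigr do rewrite !big_split /=.
rewrite DDX !big_split /= !scalerDr; congr (_ + _).
  have -> : \sum_k \sum_l r l k j i *: ((l == a)%:R *: D k v)
      = \sum_k ri a k j i *: D k v + ((q - q^-1) * (j == a)%:R) *: D i v.
    rewrite -(sum_deltaZ i (fun k => ((q - q^-1) * (j == a)%:R) *: D k v)).
    rewrite -big_split; apply: eq_bigr => k _ /=.
    transitivity (r a k j i *: D k v).
      rewrite -(sum_deltaZ a (fun l => r l k j i *: D k v)).
      by apply: eq_bigr => l _; rewrite scaler_swap.
    rewrite scalerA -scalerDl R_Rinv entryD entry_scalar.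
    by rewrite [a == j]eq_sym -mulrA mulrC -mulrA mulrCA.
  have -> : \sum_k \sum_l r l k j i *: (q^-1 *: \sum_p ri a p l k *: D p v)
      = (q^-1 * (j == a)%:R) *: D i v.
    rewrite -(sum_deltaZ i (fun p => (q^-1 * (j == a)%:R) *: D p v)).
    transitivity (\sum_p (q^-1 * entry (Rinv *m R) a p j i) *: D p v).
      under [RHS]eq_bigr do rewrite entryM mulr_sumr scaler_suml.
      rewrite exchange_big [RHS]exchange_big; apply: eq_bigr => l _ /=.
      under [RHS]eq_bigr do rewrite mulr_sumr scaler_suml.
      rewrite [RHS]exchange_big; apply: eq_bigr => k _ /=.
      rewrite !scaler_sumr; apply: eq_bigr => p _.
      by rewrite !scalerA -mulrA mulrCA [r _ _ _ _ * _]mulrC.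
    apply: eq_bigr => p _; rewrite (mulmx1C RRinv) entry_scalar mulr1 scalerA.
    by rewrite [a == j]eq_sym mulrA mulrC.
  rewrite !scalerA divff // scale1r -[RHS]addrA [LHS]addrC; congr (_ + _).
  by rewrite -scalerDl -mulrDl subrK.
transitivity (q^-1 *: (q^-1 *: \sum_l \sum_k \sum_n \sum_m
    (ri a l j k * ri k n i m) *: X m (q *: D n (D l v)))).
  rewrite [LHS]scaler_swap; congr (_ *: _); rewrite [LHS]scaler_swap; congr (_ *: _).
  rewrite scaler_sumr; apply: eq_bigr => l _; rewrite scaler_sumr.
  apply: eq_bigr => k _; rewrite scaler_sumr; apply: eq_bigr => n _.
  rewrite scaler_sumr; apply: eq_bigr => m _.
  by rewrite [X m (q *: _)]linearZ /= scaler_swap.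
under [RHS]eq_bigr do under eq_bigr do rewrite scaler_swap.
under [RHS]eq_bigr do rewrite -scaler_sumr.
rewrite -scaler_sumr; congr (_ *: _).
under [RHS]eq_bigr do under eq_bigr do rewrite scaler_swap.
under [RHS]eq_bigr do rewrite -scaler_sumr.
rewrite -scaler_sumr; congr (_ *: _).
transitivity (\sum_y \sum_x \sum_m (\sum_l \sum_n \sum_k
    r x y l n * ri a l j k * ri k n i m) *: X m (D y (D x v))).
  transitivity (\sum_l \sum_k \sum_n \sum_y \sum_x \sum_m
      (r x y l n * ri a l j k * ri k n i m) *: X m (D y (D x v))).
    apply: eq_bigr => l _; apply: eq_bigr => k _; apply: eq_bigr => n _.
    rewrite [RHS](_ : _ = \sum_m \sum_y \sum_x
      (r x y l n * ri a l j k * ri k n i m) *: X m (D y (D x v))); last first.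
      by rewrite sum_rot3.
    apply: eq_bigr => m _; rewrite IH linear_sum scaler_sumr.
    apply: eq_bigr => y _; rewrite linear_sum scaler_sumr.
    by apply: eq_bigr => x _; rewrite [X m (_ *: _)]linearZ /= scalerA mulrC mulrA.
  rewrite [LHS]sum_rot4; apply: eq_bigr => y _; rewrite [LHS]sum_rot4.
  apply: eq_bigr => x _; rewrite [LHS]sum_rot4; apply: eq_bigr => m _.
  rewrite scaler_suml; apply: eq_bigr => l _; rewrite exchange_big scaler_suml.
  by apply: eq_bigr => n _; rewrite scaler_suml.
under eq_bigr do under eq_bigr do under eq_bigr do
  rewrite -(braid_Rinv_Rinv_R RRinv YB).
under [RHS]eq_bigr do under eq_bigr do rewrite scaler_sumr.
rewrite [RHS]sum_rot3 exchange_big; apply: eq_bigr => x _ /=.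
transitivity (\sum_l \sum_b \sum_k \sum_y \sum_m
    (ri a x l b * ri b y k m * r l k j i) *: X m (D y (D x v))).
  rewrite [RHS]sum_rot4; apply: eq_bigr => y _; rewrite [RHS]sum_rot4.
  apply: eq_bigr => m _; rewrite scaler_suml; apply: eq_bigr => l _.
  by rewrite scaler_suml; apply: eq_bigr => b _; rewrite scaler_suml.
rewrite sum_rot3; apply: eq_bigr => k _; apply: eq_bigr => l _.
rewrite scaler_sumr; apply: eq_bigr => b _; rewrite scaler_sumr.
apply: eq_bigr => y _; rewrite scaler_sumr; apply: eq_bigr => m _.
by rewrite scalerA mulrC.
Qed.

End FockOperators.

(** * The reflection equation *)

Section TensorOperators.
Variables (K : fieldType) (N : nat) (V : lmodType K).
Local Notation V2 := {ffun 'I_N * 'I_N -> V}.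

Definition mxop (A : 'M[K]_(N * N)) (v : V2) : V2 :=
  [ffun p => \sum_a \sum_b entry A p.1 p.2 a b *: v (a, b)].

Fact mxop_linear A : linear (mxop A).
Proof.
move=> c u v; apply/ffunP => p; rewrite !ffunE scaler_sumr -big_split.
apply: eq_bigr => a _; rewrite scaler_sumr -big_split; apply: eq_bigr => b _ /=.
by rewrite !ffunE scalerDr scaler_swap.
Qed.
HB.instance Definition _ A := GRing.isLinear.Build K V2 V2 *:%R (mxop A) (mxop_linear A).

Lemma mxopM A B v : mxop (A *m B) v = mxop A (mxop B v).
Proof.
apply/ffunP => -[i j]; rewrite !ffunE /=.
under eq_bigr do under eq_bigr do rewrite entryM scaler_suml.
under [RHS]eq_bigr do under eq_bigr do rewrite ffunE scaler_sumr.
rewrite [LHS]sum_rot3; apply: eq_bigr => c _ /=.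
transitivity (\sum_a \sum_b \sum_d (entry A i j c d * entry B c d a b) *: v (a, b)).
  by apply: eq_bigr => a _; apply: eq_bigr => b _; rewrite scaler_suml.
rewrite sum_rot3; apply: eq_bigr => d _; apply: eq_bigr => a _.
by rewrite scaler_sumr; apply: eq_bigr => b _; rewrite scalerA.
Qed.

Lemma mxop1 c v : mxop c%:M v = c *: v.
Proof.
apply/ffunP => -[i j]; rewrite !ffunE /=.
rewrite -(sum_deltaZ i (fun a => c *: v (a, j))); apply: eq_bigr => a _.
rewrite -(sum_deltaZ j (fun b => (a == i)%:R *: (c *: v (a, b)))).
apply: eq_bigr => b _; rewrite entry_scalar !scalerA.
by rewrite [i == a]eq_sym [j == b]eq_sym mulrA [X in X * c]mulrC.
Qed.

Lemma mxopD A B v : mxop (A + B) v = mxop A v + mxop B v.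
Proof.
apply/ffunP => p; rewrite !ffunE -big_split; apply: eq_bigr => a _ /=.
by rewrite -big_split; apply: eq_bigr => b _ /=; rewrite entryD scalerDl.
Qed.

Definition op1 (L : 'I_N -> 'I_N -> V -> V) (v : V2) : V2 :=
  [ffun p => \sum_k L p.1 k (v (k, p.2))].

Lemma eq_op1 (L L' : 'I_N -> 'I_N -> V -> V) v :
  (forall i j w, L i j w = L' i j w) -> op1 L v = op1 L' v.
Proof. by move=> LL'; apply/ffunP => p; rewrite !ffunE; apply: eq_bigr. Qed.

Lemma op1_shift (L : 'I_N -> 'I_N -> V -> V) d v :
  op1 (fun i j w => L i j w - ((i == j)%:R / d) *: w) v = op1 L v - d^-1 *: v.
Proof.
apply/ffunP => -[i j]; rewrite !ffunE /= sumrB; congr (_ - _).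
rewrite -(sum_deltaZ i (fun k => d^-1 *: v (k, j))); apply: eq_bigr => k _.
by rewrite eq_sym scalerA.
Qed.

End TensorOperators.

Section ReflectionEquation.
Variables (K : fieldType) (N : nat) (q : K) (R Rinv Psi : 'M[K]_(N * N)).
Hypothesis q0 : q != 0.
Hypothesis RRinv : R *m Rinv = 1%:M.
Hypothesis R_Rinv : R = Rinv + (q - q^-1)%:M.
Hypothesis YB : R12 R *m R23 R *m R12 R = R23 R *m R12 R *m R23 R.
Hypothesis RPsi : skew_inverse R Psi.

Local Notation r := (entry R).
Local Notation ri := (entry Rinv).
Local Notation B := (Bmx Psi).

Variables (V : lmodType K) (X D : 'I_N -> {linear V -> V}).
Hypothesis XX : forall i j v,
  q *: X i (X j v) = \sum_a \sum_b r i j a b *: X a (X b v).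
Hypothesis DX : forall i j v,
  D i (X j v) = (i == j)%:R *: v + q^-1 *: \sum_l \sum_k ri j l i k *: X k (D l v).
Hypothesis DD : forall i j v,
  q *: D i (D j v) = \sum_k \sum_l r l k j i *: D k (D l v).

Local Notation V2 := {ffun 'I_N * 'I_N -> V}.
Local Notation Rop := (mxop R).

Let Y1 (u : 'I_N -> V) : V := \sum_k \sum_c B c k *: D c (u k).
Let X2 (u : 'I_N -> V) : V2 := [ffun p => X p.1 (u p.2)].
Let Y2 (v : V2) (j : 'I_N) : V := Y1 (fun k => v (k, j)).

Definition bilinear_gen (i j : 'I_N) (v : V) : V := \sum_k B k j *: X i (D k v).

Fact bilinear_gen_linear i j : linear (bilinear_gen i j).
Proof.
move=> c u v; rewrite /bilinear_gen scaler_sumr -big_split; apply: eq_bigr => k _ /=.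
by rewrite [D k _]linearP [X i _]linearP /= scalerDr scaler_swap.
Qed.
HB.instance Definition _ i j :=
  GRing.isLinear.Build K V V *:%R (bilinear_gen i j) (bilinear_gen_linear i j).

Local Notation M := (op1 bilinear_gen).

Fact M_linear : linear M.
Proof.
move=> c u v; apply/ffunP => p; rewrite !ffunE scaler_sumr -big_split.
by apply: eq_bigr => k _ /=; rewrite !ffunE linearP.
Qed.
HB.instance Definition _ := GRing.isLinear.Build K V2 V2 *:%R M M_linear.

Let M_X2Y2 v : M v = X2 (Y2 v).
Proof.
apply/ffunP => p; rewrite !ffunE /Y2 /Y1 linear_sum; apply: eq_bigr => k _.
by rewrite linear_sum; apply: eq_bigr => c _; rewrite linearZ.
Qed.

Let Y2RX2 (u : 'I_N -> V) j : Y2 (Rop (X2 u)) j = u j + q^-1 *: X j (Y1 u).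
Proof.
transitivity (\sum_a \sum_c \sum_b \sum_l (B c a * r a j b l) *:
    ((c == b)%:R *: u l + q^-1 *: \sum_n \sum_m ri b n c m *: X m (D n (u l)))).
  apply: eq_bigr => a _; apply: eq_bigr => c _.
  rewrite ffunE linear_sum scaler_sumr; apply: eq_bigr => b _.
  rewrite linear_sum scaler_sumr; apply: eq_bigr => l _.
  by rewrite linearZ /= ffunE DX scalerA.
under eq_bigr do under eq_bigr do under eq_bigr do under eq_bigr do rewrite scalerDr.
under eq_bigr do under eq_bigr do under eq_bigr do rewrite big_split.
under eq_bigr do under eq_bigr do rewrite big_split.
under eq_bigr do rewrite big_split.
rewrite big_split /=; congr (_ + _).
  transitivity (\sum_l (\sum_a \sum_c B c a * r a j c l) *: u l).
    rewrite [RHS](_ : _ = \sum_a \sum_c \sum_l (B c a * r a j c l) *: u l).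
      apply: eq_bigr => a _; apply: eq_bigr => c _; rewrite exchange_big.
      apply: eq_bigr => l _.
      rewrite -(sum_deltaZ c (fun b => (B c a * r a j b l) *: u l)).
      by apply: eq_bigr => b _; rewrite scaler_swap eq_sym.
    rewrite [RHS]sum_rot3; apply: eq_bigr => l _; rewrite scaler_suml.
    by apply: eq_bigr => a _; rewrite scaler_suml.
  under eq_bigr do rewrite (traceB RPsi) eq_sym.
  exact: sum_deltaZ.
under eq_bigr do under eq_bigr do under eq_bigr do under eq_bigr do rewrite scaler_swap.
under eq_bigr do under eq_bigr do under eq_bigr do rewrite -scaler_sumr.
under eq_bigr do under eq_bigr do rewrite -scaler_sumr.
under eq_bigr do rewrite -scaler_sumr.
rewrite -scaler_sumr; congr (_ *: _).
transitivity (\sum_l \sum_n \sum_m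
    (\sum_a \sum_c \sum_b B c a * r a j b l * ri b n c m) *: X m (D n (u l))).
  rewrite [LHS]sum_rot4; apply: eq_bigr => l _.
  under [LHS]eq_bigr do under eq_bigr do under eq_bigr do rewrite scaler_sumr.
  rewrite [LHS]sum_rot4; apply: eq_bigr => n _.
  under [LHS]eq_bigr do under eq_bigr do under eq_bigr do rewrite scaler_sumr.
  rewrite [LHS]sum_rot4; apply: eq_bigr => m _.
  rewrite scaler_suml; apply: eq_bigr => a _; rewrite scaler_suml.
  apply: eq_bigr => c _; rewrite scaler_suml; apply: eq_bigr => b _.
  by rewrite scalerA.
rewrite [Y1 u]/Y1 linear_sum; apply: eq_bigr => l _.
rewrite linear_sum; apply: eq_bigr => n _.
rewrite [X j _]linearZ /= -(sum_deltaZ j (fun m => B n l *: X m (D n (u l)))).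
apply: eq_bigr => m _.
by rewrite (traceB_R_Rinv RPsi RRinv YB) scalerA [m == j]eq_sym.
Qed.

Let Y1Y2E v :
  Y1 (Y2 v) = \sum_k \sum_l \sum_n \sum_c (B n l * B c k) *: D n (D c (v (k, l))).
Proof.
rewrite [RHS]exchange_big; apply: eq_bigr => l _; rewrite [RHS]exchange_big.
apply: eq_bigr => n _; rewrite linear_sum scaler_sumr; apply: eq_bigr => k _.
rewrite linear_sum scaler_sumr; apply: eq_bigr => c _.
by rewrite linearZ scalerA.
Qed.

Let XXY v : V2 := [ffun p => X p.1 (X p.2 (Y1 (Y2 v)))].

Let MRM v : M (Rop (M v)) = M v + q^-1 *: XXY v.
Proof.
rewrite [in LHS]M_X2Y2 [M v]M_X2Y2; apply/ffunP => p.
by rewrite !ffunE Y2RX2 linearD linearZ.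
Qed.

Let RXXY v : Rop (XXY v) = q *: XXY v.
Proof.
apply/ffunP => p; rewrite !ffunE XX; apply: eq_bigr => a _.
by apply: eq_bigr => b _; rewrite ffunE.
Qed.

Let XXYR v : XXY (Rop v) = q *: XXY v.
Proof.
suff E : Y1 (Y2 (Rop v)) = q *: Y1 (Y2 v).
  by apply/ffunP => p; rewrite !ffunE E [X p.2 _]linearZ [X p.1 _]linearZ.
rewrite !Y1Y2E.
transitivity (\sum_a \sum_b \sum_n \sum_c
    (\sum_k \sum_l B c k * B n l * r k l a b) *: D n (D c (v (a, b)))).
  rewrite [RHS](_ : _ = \sum_k \sum_l \sum_a \sum_b \sum_n \sum_c
      (B c k * B n l * r k l a b) *: D n (D c (v (a, b)))).
    apply: eq_bigr => k _; apply: eq_bigr => l _.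
    rewrite [RHS](_ : _ = \sum_n \sum_c \sum_a \sum_b
      (B c k * B n l * r k l a b) *: D n (D c (v (a, b)))).
      apply: eq_bigr => n _; apply: eq_bigr => c _.
      rewrite ffunE linear_sum linear_sum scaler_sumr; apply: eq_bigr => a _.
      rewrite linear_sum linear_sum scaler_sumr; apply: eq_bigr => b _.
      by rewrite [D c _]linearZ [D n _]linearZ scalerA [B n l * _]mulrC.
    rewrite [RHS]sum_rot4 [RHS]sum_rot4.
    by apply: eq_bigr => a _; rewrite exchange_big.
  rewrite [RHS]sum_rot3; apply: eq_bigr => a _.
  rewrite [RHS]sum_rot3; apply: eq_bigr => b _.
  rewrite [RHS]sum_rot3; apply: eq_bigr => n _.
  rewrite [RHS]sum_rot3; apply: eq_bigr => c _; rewrite scaler_suml.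
  by apply: eq_bigr => k _; rewrite scaler_suml.
under eq_bigr do under eq_bigr do under eq_bigr do under eq_bigr do
  rewrite (BB_R RPsi RRinv R_Rinv YB).
rewrite scaler_sumr; apply: eq_bigr => a _; rewrite scaler_sumr; apply: eq_bigr => b _.
transitivity (\sum_x \sum_y \sum_n \sum_c
    (r c n x y * (B x a * B y b)) *: D n (D c (v (a, b)))).
  rewrite [RHS](_ : _ = \sum_n \sum_x \sum_y \sum_c
      (r c n x y * (B x a * B y b)) *: D n (D c (v (a, b)))).
    apply: eq_bigr => n _; rewrite [RHS]sum_rot3; apply: eq_bigr => c _.
    by rewrite scaler_suml; apply: eq_bigr => x _; rewrite scaler_suml.
  by rewrite sum_rot3.
rewrite exchange_big scaler_sumr; apply: eq_bigr => y _; rewrite scaler_sumr.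
apply: eq_bigr => x _; rewrite [RHS]scaler_swap DD scaler_sumr.
apply: eq_bigr => n _; rewrite scaler_sumr; apply: eq_bigr => c _.
by rewrite scalerA mulrC [B y b * _]mulrC.
Qed.

Lemma bilinear_gen_reflection v :
  Rop (M (Rop (M v))) - M (Rop (M (Rop v))) = Rop (M v) - M (Rop v).
Proof.
rewrite !MRM XXYR linearD linearZ /= RXXY scalerA mulVf // scale1r.
by rewrite opprD addrACA subrr addr0.
Qed.

(* Shifting by 1/(q - 1/q) removes the linear terms. *)
Lemma bilinear_gen_shift_reflection (L : V2 -> V2) :
    q - q^-1 != 0 -> (forall v, L v = M v - (q - q^-1)^-1 *: v) ->
  forall v, Rop (L (Rop (L v))) = L (Rop (L (Rop v))).
Proof.
move=> d0 LE v.
set d := q - q^-1; set c := d^-1.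
have RE u : Rop u = mxop Rinv u + d *: u by rewrite R_Rinv mxopD mxop1.
have RR w : Rop (Rop w) = w + d *: Rop w.
  by rewrite {1}RE -mxopM (mulmx1C RRinv) mxop1 scale1r.
have cRR w : c *: Rop (Rop w) = c *: w + Rop w.
  by rewrite RR scalerDr scalerA mulVf // scale1r.
have RB u w : Rop (u - w) = Rop u - Rop w by rewrite linearB.
have RZ e u : Rop (e *: u) = e *: Rop u by rewrite linearZ.
have MB u w : M (u - w) = M u - M w by rewrite linearB.
have MZ e u : M (e *: u) = e *: M u by rewrite linearZ.
have MD u w : M (u + w) = M u + M w by rewrite linearD.
have -> : Rop (L (Rop (L v))) = Rop (M (Rop (M v))) - c *: Rop (M (Rop v))
    - (c *: Rop (Rop (M v)) - c *: (c *: Rop (Rop v))).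
  by rewrite !LE !(RB, RZ, MB, MZ, scalerBr).
have -> : L (Rop (L (Rop v))) = M (Rop (M (Rop v))) - c *: M (Rop (Rop v))
    - (c *: Rop (M (Rop v)) - c *: (c *: Rop (Rop v))).
  by rewrite !LE !(RB, RZ, MB, MZ, scalerBr).
have -> : c *: M (Rop (Rop v)) = c *: M v + M (Rop v).
  by rewrite -MZ cRR MD MZ.
have <- : Rop (M (Rop (M v))) - (Rop (M v) - M (Rop v)) = M (Rop (M (Rop v))).
  by rewrite -bilinear_gen_reflection opprB addrCA subrr addr0.
rewrite cRR !(opprB, opprD) !addrA.
by rewrite [RHS](ACl (1*7*6*4*3*(2*5)))%AC /= subrr addr0.
Qed.

End ReflectionEquation.

(** * Actions of matrices and normal ordering *)

Section MatrixActions.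
Variables (K : fieldType) (A : lalgType K) (V : lmodType K) (e : A -> V -> V).
Hypothesis act_e : action e.
Variable N : nat.
Local Notation V2 := {ffun 'I_N * 'I_N -> V}.

Definition opmx (Z : 'M[A]_(N * N)) (v : V2) : V2 :=
  [ffun p => \sum_a \sum_b e (Z (mxtens_index p) (mxtens_index (a, b))) (v (a, b))].

Lemma opmxB Y Z v : opmx (Y - Z) v = opmx Y v - opmx Z v.
Proof.
apply/ffunP => p; rewrite !ffunE -sumrB; apply: eq_bigr => a _.
rewrite -sumrB; apply: eq_bigr => b _; rewrite !mxE; exact: (actionB act_e).
Qed.

Lemma opmxM Y Z v : opmx (Y *m Z) v = opmx Y (opmx Z v).
Proof.
have [lin _ _ eM] := act_e.
pose eL a : {linear V -> V} :=
  HB.pack (e a) (GRing.isLinear.Build K V V *:%R (e a) (lin a)).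
apply/ffunP => p; rewrite !ffunE.
under eq_bigr do under eq_bigr do rewrite mxE sum_mxtens (action_sum act_e).
rewrite [LHS]sum_rot3; apply: eq_bigr => c _ /=.
transitivity (\sum_a \sum_b \sum_d
    e (Y (mxtens_index p) (mxtens_index (c, d)))
      (e (Z (mxtens_index (c, d)) (mxtens_index (a, b))) (v (a, b)))).
  apply: eq_bigr => a _; apply: eq_bigr => b _; rewrite (action_sum act_e).
  by apply: eq_bigr => d _; rewrite eM.
rewrite sum_rot3; apply: eq_bigr => d _; rewrite ffunE.
rewrite -[RHS]/(eL _ _) linear_sum; apply: eq_bigr => a _.
by rewrite linear_sum.
Qed.

Lemma opmx_scalars (M : 'M[K]_(N * N)) v : opmx (map_mx (in_alg A) M) v = mxop M v.
Proof.
have [_ _ e1 _] := act_e.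
apply/ffunP => -[i j]; rewrite !ffunE; apply: eq_bigr => a _; apply: eq_bigr => b _.
by rewrite mxE /= (actionZ act_e) e1.
Qed.

Lemma opmx_tens1 (L : 'M[A]_N) v :
  opmx (L *t 1%:M) v = op1 (fun i j => e (L i j)) v.
Proof.
apply/ffunP => -[i j]; rewrite !ffunE /=; apply: eq_bigr => a _.
rewrite -(sum_deltaZ j (fun b => e (L i a) (v (a, b)))); apply: eq_bigr => b _.
rewrite tensmxE mxE [j == b]eq_sym; case: eqP => _ /=.
  by rewrite mulr1 scale1r.
by rewrite mulr0 scale0r (action0 act_e).
Qed.

Lemma opmx_eq0 Z : (forall v, opmx Z v = 0) -> forall x y f, e (Z x y) f = 0.
Proof.
move=> Z0 x y f; case: (mxtens_indexP x) (mxtens_indexP y) => i j [k l].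
have [lin _ _ _] := act_e.
have e0 a : e a 0 = 0 by apply: (action_linear0 act_e).
have := congr1 (fun v : V2 => v (i, j)) (Z0 [ffun p => if p == (k, l) then f else 0]).
rewrite !ffunE (bigD1 k) //= (bigD1 l) //= !big1 ?addr0.
- by rewrite ffunE eqxx.
- move=> a ak; apply: big1 => b _; rewrite ffunE xpair_eqE (negbTE ak) /=; exact: e0.
- by move=> b bl; rewrite ffunE xpair_eqE (negbTE bl) andbF; apply: e0.
Qed.

Lemma yangian_rel_action (R Rinv : 'M[K]_(N * N)) (d : K)
    (Lf Lp : nat -> 'M[A]_N) (L : V2 -> V2) :
    linear L -> R *m Rinv = 1%:M -> R = Rinv + d%:M ->
    (forall v, mxop R (L (mxop R (L v))) = L (mxop R (L (mxop R v)))) ->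
    Lp 0%N = 0 -> (forall k, Lp k.+1 = Lf k) ->
    (forall i j v, e (Lf 0%N i j) v = (i == j)%:R *: v) ->
    (forall v, op1 (fun i j => e (Lf 1%N i j)) v = L v) ->
    (forall k i j v, e (Lf k.+2 i j) v = 0) ->
  forall r s x y f,
  e (((map_mx (in_alg A) Rinv *m (Lf r *t 1%:M) *m map_mx (in_alg A) R *m (Lp s *t 1%:M)
      - map_mx (in_alg A) R *m (Lp r *t 1%:M) *m map_mx (in_alg A) R *m (Lf s *t 1%:M))
     - ((Lp s *t 1%:M) *m map_mx (in_alg A) R *m (Lf r *t 1%:M) *m map_mx (in_alg A) Rinv
        - (Lf s *t 1%:M) *m map_mx (in_alg A) R *m (Lp r *t 1%:M) *m map_mx (in_alg A) R))
     x y) f = 0.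
Proof.
move=> linL RRinv R_Rinv RE Lp0 LpS Lf0 Lf1 Lf2 r s x y f; move: x y f.
apply: opmx_eq0 => v; rewrite !opmxB !opmxM !opmx_scalars !opmx_tens1.
set O := fun (k : nat) v => op1 (fun i j => e (Lf k i j)) v.
set P := fun (k : nat) v => op1 (fun i j => e (Lp k i j)) v.
have O0 u : O 0%N u = u.
  apply/ffunP => -[i j]; rewrite ffunE /=; under eq_bigr do rewrite Lf0 eq_sym.
  exact: sum_deltaZ.
have O1 u : O 1%N u = L u by rewrite -Lf1.
have O2 k u : O k.+2 u = 0.
  by apply/ffunP => p; rewrite !ffunE big1 // => k' _; rewrite Lf2.
have P0 u : P 0%N u = 0.
  apply/ffunP => p; rewrite !ffunE big1 // => k _.
  by rewrite Lp0 mxE; apply: (action0 act_e).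
have PS k u : P k.+1 u = O k u by rewrite /P /O LpS.
have L0 : L 0 = 0 by rewrite -{1}(addNr 0) -scaleN1r linL scaleN1r addNr.
have RinvR u : mxop Rinv (mxop R u) = u by rewrite -mxopM (mulmx1C RRinv) mxop1 scale1r.
have RRinv' u : mxop R (mxop Rinv u) = u by rewrite -mxopM RRinv mxop1 scale1r.
have RinvE u : mxop Rinv u = mxop R u - d *: u by rewrite R_Rinv mxopD mxop1 addrK.
have LB u w : L (u - w) = L u - L w.
  by rewrite addrC -scaleN1r linL scaleN1r addrC.
have LD u w : L (u + w) = L u + L w by rewrite -{1}[u]scale1r linL scale1r.
have LZ c u : L (c *: u) = c *: L u by rewrite -[c *: u]addr0 linL L0 addr0.
have RB u w : mxop R (u - w) = mxop R u - mxop R w by rewrite linearB.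
have RZ c u : mxop R (c *: u) = c *: mxop R u by rewrite linearZ.
change (mxop Rinv (O r (mxop R (P s v))) - mxop R (P r (mxop R (O s v)))
  - (P s (mxop R (O r (mxop Rinv v))) - O s (mxop R (P r (mxop R v)))) = 0).
case: r => [|[|[|r]]]; case: s => [|[|[|s]]];
  rewrite ?(PS, P0, O0, O1, O2, linear0, L0, subrr, subr0, sub0r,
    addr0, oppr0, RinvR, RRinv') //.
- have RR u : mxop R (mxop R u) = u + d *: mxop R u.
    by apply/eqP; rewrite -subr_eq -RZ -RB -RinvE RRinv'.
  rewrite !RinvE LB LZ !RR LD LZ RB RZ !(opprB, opprD) !addrA.
  by rewrite (ACl ((1*8)*(2*6)*(3*5)*(4*7)))%AC /= !(subrr, addNr, addr0).
- by rewrite !RinvE LB LZ RB RZ LB LZ RE subrr.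
- by rewrite RE subrr.
Qed.

End MatrixActions.

Section NormalOrdering.
Variables (K : fieldType) (A B C : lalgType K) (I : finType).
Variables (xV xD : I -> A) (gV : I -> B) (gD : I -> C) (iV : B -> A) (iD : C -> A).
Variables (t : K) (c : I -> I -> I -> I -> K) (S : A -> Prop).
Hypothesis scaleAr : forall k (a b : A), a * (k *: b) = k *: (a * b).
Hypothesis iVP : forall k b1 b2, iV (k *: b1 + b2) = k *: iV b1 + iV b2.
Hypotheses (iV1 : iV 1 = 1) (iD1 : iD 1 = 1).
Hypothesis iVg : forall i b, iV (gV i * b) = xV i * iV b.
Hypothesis iDg : forall i, iD (gD i) = xD i.
Hypothesis B_ind : forall P : B -> Prop, P 1 ->
  (forall k a b, P a -> P b -> P (k *: a + b)) -> (forall i a, P a -> P (gV i * a)) ->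
  forall a, P a.
Hypothesis permS : forall i j, ideal S (xD i * xV j
  - ((i == j)%:R + t *: \sum_k \sum_l c j l i k *: (xV k * xD l))).

Let ordered (z : A) : Prop :=
  exists s : seq (B * C), ideal S (z - \sum_(p <- s) iV p.1 * iD p.2).

Let iV0 : iV 0 = 0.
Proof. by rewrite -{1}(addNr 0) -scaleN1r iVP scaleN1r addNr. Qed.

Let ordered_iV b : ordered (iV b).
Proof.
by exists [:: (b, 1)]; rewrite big_seq1 iD1 mulr1 subrr; apply: ideal0.
Qed.

Let orderedP k z1 z2 : ordered z1 -> ordered z2 -> ordered (k *: z1 + z2).
Proof.
move=> [s1 I1] [s2 I2]; exists ([seq (k *: p.1, p.2) | p <- s1] ++ s2).
rewrite big_cat big_map /=.
have -> : \sum_(p <- s1) iV (k *: p.1) * iD p.2 = k *: \sum_(p <- s1) iV p.1 * iD p.2.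
  rewrite scaler_sumr; apply: eq_bigr => p _.
  by rewrite -[k *: p.1]addr0 iVP iV0 addr0 scalerAl.
by rewrite opprD addrACA -scalerBr; apply: idealD => //; apply: idealZ.
Qed.

Let ordered_sum (J : finType) (F : J -> A) :
  (forall j, ordered (F j)) -> ordered (\sum_j F j).
Proof.
move=> oF; elim/big_rec: _ => [|j z _ oz]; first by rewrite -iV0.
by rewrite -[F j]scale1r; apply: orderedP.
Qed.

Let orderedZ k z : ordered z -> ordered (k *: z).
Proof. by move=> oz; rewrite -[k *: z]addr0 -iV0; apply: orderedP. Qed.

Let ordered_xV i z : ordered z -> ordered (xV i * z).
Proof.
move=> [s Is]; exists [seq (gV i * p.1, p.2) | p <- s]; rewrite big_map /=.
have -> : \sum_(p <- s) iV (gV i * p.1) * iD p.2 = xV i * \sum_(p <- s) iV p.1 * iD p.2.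
  by rewrite mulr_sumr; apply: eq_bigr => p _; rewrite iVg mulrA.
by rewrite -mulrBr; apply: idealMl.
Qed.

Let ordered_ideal z1 z2 : ideal S (z1 - z2) -> ordered z2 -> ordered z1.
Proof. by move=> I12 [s Is]; exists s; rewrite -(subrKA z2); apply: idealD. Qed.

Lemma normal_ordering b i :
  exists s : seq (B * C), ideal S (xD i * iV b - \sum_(p <- s) iV p.1 * iD p.2).
Proof.
rewrite -/(ordered (xD i * iV b)).
elim/B_ind: b i => [|k b1 b2 IH1 IH2|j b IH] i.
- by exists [:: (1, gD i)]; rewrite big_seq1 iV1 iDg mulr1 mul1r subrr; apply: ideal0.
- by rewrite iVP mulrDr scaleAr; apply: orderedP.
rewrite iVg mulrA; have := @Defs.idealMr _ _ _ _ (iV b) (permS i j).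
rewrite mulrBl => /ordered_ideal; apply.
rewrite mulrDl -scalerAl addrC; apply: orderedP.
  rewrite mulr_suml; apply: ordered_sum => k; rewrite mulr_suml.
  apply: ordered_sum => l; rewrite -scalerAl -mulrA; apply: orderedZ.
  exact: ordered_xV.
by rewrite mulr_natl -scaler_nat; apply: orderedZ; apply: ordered_iV.
Qed.

End NormalOrdering.

(** * The Fock space *)

Section FreeMap.
Variables (K : fieldType) (I J : choiceType) (s : I -> J).

Lemma free_mapP c (f g : free_alg K I) :
  free_map s (c *: f + g) = c *: free_map s f + free_map s g.
Proof. exact: lext_linear. Qed.

Lemma free_map1 : free_map s 1 = 1 :> free_alg K J.
Proof. by rewrite /free_map; etransitivity; [apply: lextU | rewrite fm1 big_nil]. Qed.

Lemma free_map_genM i (f : free_alg K I) :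
  free_map s (gen K i * f) = gen K (s i) * free_map s f.
Proof.
etransitivity; first exact: lext_gen.
rewrite /lext /free_map mulr_sumr; apply: eq_bigr => m _.
by rewrite fmM fmU big_cons scaler_free_algAr.
Qed.

Lemma free_map_gen i : free_map s (gen K i) = gen K (s i).
Proof. by rewrite -[gen K i]mulr1 free_map_genM free_map1 mulr1. Qed.

Let action_ext (A : lalgType K) (X : Type) (g : X -> A) (V : lmodType K)
    (e e' : A -> V -> V) v :
    (forall P : A -> Prop, P 1 -> (forall c a b, P a -> P b -> P (c *: a + b)) ->
       (forall i a, P a -> P (g i * a)) -> forall a, P a) ->
    (forall c a b, e (c *: a + b) v = c *: e a v + e b v) ->
    (forall c a b, e' (c *: a + b) v = c *: e' a v + e' b v) ->
    e 1 v = e' 1 v ->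
    (forall i a, e a v = e' a v -> e (g i * a) v = e' (g i * a) v) ->
  forall a, e a v = e' a v.
Proof.
by move=> ind eP eP' e1 eg; elim/ind => // c a b IHa IHb; rewrite eP eP' IHa IHb.
Qed.

Lemma ev_free_map (V : lmodType K) (t : J -> {linear V -> V}) f v :
  ev t (free_map s f) v = ev (fun i => t (s i)) f v.
Proof.
have [_ eP e1 _] := ev_action t; have [_ eP' e1' _] := ev_action (fun i => t (s i)).
apply: (action_ext (e := fun f => ev t (free_map s f)) (@free_alg_ind K I)).
- by move=> c a b; rewrite free_mapP eP.
- by move=> c a b; rewrite eP'.
- by rewrite free_map1 e1 e1'.
- by move=> i a IH; rewrite free_map_genM !ev_genM IH.
Qed.

End FreeMap.

Lemma mcoeff1M (K : fieldType) (M : monomType) (f g : {malg K[M]}) :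
  @mcoeff M K (@mone M) (f * g) = @mcoeff M K (@mone M) f * @mcoeff M K (@mone M) g.
Proof. exact: rmorphM. Qed.

Section ConstTerm.
Variables (K : fieldType) (I : choiceType).

Lemma const_termP c (f g : free_alg K I) :
  const_term (c *: f + g) = c * const_term f + const_term g.
Proof. by rewrite /const_term mcoeffD mcoeffZ. Qed.

Lemma const_term1 : const_term (1 : free_alg K I) = 1.
Proof. by rewrite /const_term mcoeff1 eqxx. Qed.

Lemma const_term_genM i (f : free_alg K I) : const_term (gen K i * f) = 0.
Proof.
rewrite /const_term; etransitivity; first exact: mcoeff1M.
by rewrite mcoeffU -val_eqE /= fmU fm1 mul0r.
Qed.

End ConstTerm.

Lemma action_quadratic (K : fieldType) (A : lalgType K) (V : lmodType K)
    (e : A -> V -> V) (I : finType) (g : I -> A) (s : I -> V -> V) :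
    action e -> (forall i v, e (g i) v = s i v) ->
  forall t (c : I -> I -> K) i j v,
  e (t *: (g i * g j) - \sum_a \sum_b c a b *: (g a * g b)) v
  = t *: s i (s j v) - \sum_a \sum_b c a b *: s a (s b v).
Proof.
move=> act_e eg t c i j v; have [_ _ _ eM] := act_e.
rewrite (actionB act_e) (actionZ act_e) eM !eg (action_sum act_e); congr (_ - _).
apply: eq_bigr => a _; rewrite (action_sum act_e); apply: eq_bigr => b _.
by rewrite (actionZ act_e) eM !eg.
Qed.

Section Fock.
Variables (K : fieldType) (N : nat) (q : K) (R Rinv : 'M[K]_(N * N)).
Hypothesis q0 : q != 0.
Hypothesis RRinv : R *m Rinv = 1%:M.
Hypothesis R_Rinv : R = Rinv + (q - q^-1)%:M.
Hypothesis YB : R12 R *m R23 R *m R12 R = R23 R *m R12 R *m R23 R.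

Local Notation r := (entry R).
Local Notation ri := (entry Rinv).
Local Notation F := (fock q R).
Local Notation symS := (fun z => exists i j, z = sym_rel q R i j).
Local Notation clsF := (@cls K _ symS).

Fact creation_linear i : linear (@creation K N q R i).
Proof.
move=> c f g; rewrite /creation mulrDr; congr (_ + _).
rewrite -[f]cls_reprK -linearZ -!clsM -linearZ; congr (cls _ _).
exact: scaler_free_algAr.
Qed.
HB.instance Definition _ i :=
  GRing.isLinear.Build K F F *:%R (@creation K N q R i) (creation_linear i).

Definition crea (i : 'I_N) : {linear F -> F} := @creation K N q R i.

Lemma ev_crea z f : ev crea z f = clsF z * f.
Proof.
have [_ eP e1 _] := ev_action crea.
elim/free_alg_ind: z => [|c z1 z2 IH1 IH2|i z IH].
- by rewrite e1 mul1r.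
- rewrite eP IH1 IH2 linearP mulrDl; congr (_ + _).
  rewrite -[f]cls_reprK -clsM -linearZ -[in RHS]linearZ -[RHS]clsM; congr (cls _ _).
  exact: scalerAl.
- have E : clsF (gen K i * z) = clsF (gen K i) * clsF z by exact: clsM.
  by rewrite ev_genM IH E; apply: mulrA.
Qed.

Lemma crea_sym i j v :
  q *: crea i (crea j v) = \sum_a \sum_b r i j a b *: crea a (crea b v).
Proof.
have Q := action_quadratic (ev_action crea) (ev_gen crea) q (r i j) i j v.
apply/eqP; rewrite -subr_eq0 -Q ev_crea -[clsF _](_ : 0 = _) ?mul0r //.
by apply/esym/cls_ideal/ideal_gen; exists i, j.
Qed.

Local Notation W := {ffun option 'I_N -> F}.

Definition shift_crea (j : 'I_N) : {linear W -> W} := shift q Rinv crea j.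

Lemma shift_crea_sym z : symS z -> forall w, ev shift_crea z w = 0.
Proof.
move=> [i [j ->]] w.
have Q := action_quadratic (ev_action shift_crea) (ev_gen shift_crea) q (r i j) i j w.
apply: etrans Q _; apply/eqP; rewrite subr_eq0; apply/eqP.
exact: (shift_sym_rel q0 RRinv R_Rinv YB crea_sym).
Qed.

Definition vacuum : W := [ffun o => if o is Some _ then 0 else clsF 1].

Lemma ev_shift_vacuum z : ev shift_crea z vacuum None = clsF z.
Proof.
have [_ eP e1 _] := ev_action shift_crea.
elim/free_alg_ind: z => [|c z1 z2 IH1 IH2|i z IH].
- by rewrite e1 ffunE.
- apply: etrans (congr1 (fun w : W => w None) (eP _ _ _ _)) _.
  apply: etrans (ffun_lincomb _ _ _ _) _.
  apply: etrans (congr2 (fun a b => c *: a + b) IH1 IH2) _.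
  exact/esym/linearP.
- have E : clsF (gen K i * z) = crea i (clsF z) by exact: clsM.
  by rewrite ev_genM E -IH; apply: shift_None.
Qed.

Definition partial_fun (i : 'I_N) (f : F) : F :=
  quot_act (ev shift_crea) f vacuum (Some i).

Lemma partial_fun_cls i z : partial_fun i (clsF z) = ev shift_crea z vacuum (Some i).
Proof.
have E := quot_act_cls (ev_action shift_crea) shift_crea_sym z vacuum.
exact: (congr1 (fun w : W => w (Some i)) E).
Qed.

Fact partial_fun_linear i : linear (partial_fun i).
Proof.
move=> c f g; rewrite /partial_fun.
have [_ P _ _] := quot_act_representation (ev_action shift_crea) shift_crea_sym.
apply: etrans (congr1 (fun w : W => w (Some i)) (P _ _ _ _)) _.
exact: ffun_lincomb.
Qed.
HB.instance Definition _ i :=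
  GRing.isLinear.Build K F F *:%R (partial_fun i) (partial_fun_linear i).

Definition partial (i : 'I_N) : {linear F -> F} := partial_fun i.

Lemma partial1 i : partial i (clsF 1) = 0.
Proof.
have [_ _ e1 _] := ev_action shift_crea.
by rewrite [LHS]partial_fun_cls e1 ffunE.
Qed.

Lemma partial_crea i j f :
  partial i (crea j f)
  = (i == j)%:R *: f + q^-1 *: \sum_l \sum_k ri j l i k *: crea k (partial l f).
Proof.
rewrite -[f]cls_reprK; set z := repr f.
have -> : crea j (clsF z) = clsF (gen K j * z) by apply/esym/clsM.
rewrite [LHS]partial_fun_cls ev_genM.
exact: (shift_Some q Rinv crea j i (ev_shift_vacuum z)
  (fun l => esym (partial_fun_cls l z))).
Qed.

Lemma fock_ind (P : F -> Prop) : P (clsF 1) ->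
  (forall c f g, P f -> P g -> P (c *: f + g)) -> (forall i f, P f -> P (crea i f)) ->
  forall f, P f.
Proof.
move=> P1 PD PX f; rewrite -[f]cls_reprK.
elim/free_alg_ind: (repr f) => [//|c z1 z2 IH1 IH2|i z IH].
  by rewrite linearP; apply: PD.
have -> : clsF (gen K i * z) = crea i (clsF z) by exact: clsM.
exact: PX.
Qed.

Lemma partial_partial i j f :
  q *: partial i (partial j f) = \sum_k \sum_l r l k j i *: partial k (partial l f).
Proof. exact: (DD q0 RRinv R_Rinv YB partial_crea partial1 fock_ind). Qed.

Hypothesis Rinv_invmx : invmx R = Rinv.

Definition double_op (t : 'I_N + 'I_N) : {linear F -> F} :=
  match t with inl i => crea i | inr i => partial i end.

Lemma double_op_rel z : double_rel q R z -> forall f, ev double_op z f = 0.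
Proof.
have [lin eP e1 eM] := ev_action double_op.
case=> i [j [->|->|->]] f.
- rewrite /in_V ev_free_map -[LHS]/(ev crea _ f) ev_crea.
  rewrite [clsF _](_ : _ = 0) ?mul0r //.
  by apply/cls_ideal/ideal_gen; exists i, j.
- rewrite /in_dual ev_free_map -[LHS]/(ev partial _ f).
  have Q := action_quadratic (ev_action partial) (ev_gen partial) q
    (fun k l => r l k j i) i j f.
  by apply: etrans Q _; rewrite partial_partial subrr.
apply: (etrans (actionB (ev_action double_op) _ _ _)).
apply/eqP; rewrite subr_eq0; apply/eqP.
rewrite eM !ev_gen -[LHS]/(partial i (crea j f)) partial_crea.
apply/esym/(etrans (actionD (ev_action double_op) _ _ _)); congr (_ + _).
  have -> : (i == j)%:R = (i == j)%:R *: 1 :> free_alg K ('I_N + 'I_N)%type.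
    by rewrite scaler_nat.
  by apply: (etrans (actionZ (ev_action double_op) _ _ _)); rewrite e1.
apply: (etrans (actionZ (ev_action double_op) _ _ _)); congr (_ *: _).
rewrite (action_sum (ev_action double_op)) [RHS]exchange_big; apply: eq_bigr => k _ /=.
rewrite (action_sum (ev_action double_op)); apply: eq_bigr => l _.
by rewrite (actionZ (ev_action double_op)) eM !ev_gen Rinv_invmx.
Qed.

Lemma ev_in_dual p : ev double_op (in_dual p) (clsF 1) = const_term p *: clsF 1.
Proof.
rewrite /in_dual ev_free_map -[LHS]/(ev partial _ _).
have [_ eP e1 _] := ev_action partial.
elim/free_alg_ind: p => [|c p1 p2 IH1 IH2|i p IH].
- by rewrite e1 const_term1 scale1r.
- by rewrite eP IH1 IH2 const_termP scalerDl scalerA.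
- by rewrite ev_genM IH const_term_genM linearZ /= [partial_fun i _]partial1 scaler0
    scale0r.
Qed.

Lemma ev_in_V z : ev double_op (in_V z) (clsF 1) = clsF z.
Proof.
rewrite /in_V ev_free_map -[LHS]/(ev crea _ _) ev_crea; exact: mulr1.
Qed.

Lemma moves_to_partial i f g : moves_to i f g -> g = partial i f.
Proof.
case=> f0 [s [-> /(action_ideal (ev_action double_op) double_op_rel) E ->]].
have [lin eP e1 eM] := ev_action double_op.
have {}E := E (clsF 1).
have E1 : ev double_op (gen K (inr i) * in_V f0) (clsF 1) = partial i (clsF f0).
  by rewrite eM ev_gen ev_in_V.
have E2 : ev double_op (\sum_(p <- s) in_V p.1 * in_dual p.2) (clsF 1)
    = \sum_(p <- s) const_term p.2 *: clsF p.1.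
  rewrite (action_sum (ev_action double_op)); apply: eq_bigr => p _.
  apply: etrans (eM _ _ _) _.
  apply: etrans (congr1 (ev double_op (in_V p.1)) (ev_in_dual p.2)) _.
  apply: etrans (action_linearZ (ev_action double_op) _ _ _) _.
  exact: (congr1 (fun x : F => const_term p.2 *: x) (ev_in_V p.1)).
rewrite (actionB (ev_action double_op)) in E.
by move/eqP: E; rewrite subr_eq0 E1 E2 => /eqP ->.
Qed.

Lemma moves_to_ex i f : exists g, @moves_to K N q R i f g.
Proof.
have [s Is] : exists s : seq (free_alg K 'I_N * free_alg K 'I_N),
    ideal (double_rel q R) (gen K (inr i) * in_V (repr f)
      - \sum_(p <- s) in_V p.1 * in_dual p.2).
  apply: (@normal_ordering K (free_alg K ('I_N + 'I_N)%type) (free_alg K 'I_N)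
    (free_alg K 'I_N) 'I_N (fun i => gen K (inl i)) (fun i => gen K (inr i))
    (@gen K 'I_N) (@gen K 'I_N) (@in_V K N) (@in_dual K N) q^-1 (entry (invmx R))
    (double_rel q R)).
  - exact: scaler_free_algAr.
  - exact: free_mapP.
  - exact: free_map1.
  - exact: free_map1.
  - exact: free_map_genM.
  - exact: free_map_gen.
  - exact: free_alg_ind.
  - by move=> k l; apply: ideal_gen; exists k, l; constructor 3.
eexists; exists (repr f), s; split; [by rewrite cls_reprK | exact: Is | reflexivity].
Qed.

Lemma annihilation_partial i f : annihilation i f = partial i f.
Proof.
rewrite /annihilation; case: xgetP => [g _ /moves_to_partial //|none].
by have [g /none] := moves_to_ex i f.
Qed.

End Fock.

(** * The representation *)

Lemma hecke_inverse (K : fieldType) n (q : K) (R : 'M[K]_n) : q != 0 ->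
  (q%:M - R) *m (q^-1%:M + R) = 0 -> R *m (R - (q - q^-1)%:M) = 1%:M.
Proof.
move=> q0; rewrite mulmxDl mulNmx !mulmxDr -scalar_mxM divff // mul_scalar_mx.
rewrite mul_mx_scalar => /eqP; rewrite subr_eq0 => /eqP E.
by rewrite mulmxN mul_mx_scalar scalerBl opprB addrA [X in X - _]addrC -E addrK.
Qed.

Section BraidedYangianAction.
Variables (K : fieldType) (N : nat) (q : K) (R Rinv Psi : 'M[K]_(N * N)).
Hypothesis q0 : q != 0.
Hypothesis d0 : q - q^-1 != 0.
Hypothesis RRinv : R *m Rinv = 1%:M.
Hypothesis R_Rinv : R = Rinv + (q - q^-1)%:M.
Hypothesis YB : R12 R *m R23 R *m R12 R = R23 R *m R12 R *m R23 R.
Hypothesis RPsi : skew_inverse R Psi.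

Local Notation F := (fock q R).
Local Notation T := (free_alg K ('I_N * 'I_N * nat)%type).
Local Notation be := (bilinear_gen Psi (crea q R) (partial q0 RRinv R_Rinv YB)).
Local Notation V2 := {ffun 'I_N * 'I_N -> F}.

Definition yangian_op (t : 'I_N * 'I_N * nat) (f : F) : F :=
  let: (i, j, k) := t in
  if k is 0 then be i j f - ((i == j)%:R / (q - q^-1)) *: f else 0.

Fact yangian_op_linear t : linear (yangian_op t).
Proof.
case: t => -[i j] [|k] c f g /=; last by rewrite scaler0 addr0.
by rewrite bilinear_gen_linear scalerDr opprD addrACA scalerBr [_ *: (c *: _)]scaler_swap.
Qed.
HB.instance Definition _ t :=
  GRing.isLinear.Build K F F *:%R (yangian_op t) (yangian_op_linear t).

Definition yangian_genop (t : 'I_N * 'I_N * nat) : {linear F -> F} := yangian_op t.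

Let L (v : V2) : V2 := op1 be v - (q - q^-1)^-1 *: v.

Let L_linear : linear L.
Proof.
move=> c u v; rewrite /L M_linear scalerDr opprD addrACA scalerBr.
by rewrite [_ *: (c *: _)]scaler_swap.
Qed.

Lemma yangian_genop_rel z : (exists r s a b, z = yangian_rel q R r s a b) ->
  forall f, ev yangian_genop z f = 0.
Proof.
have Rinv_def : Rinv = R - (q - q^-1)%:M by rewrite R_Rinv addrK.
case=> r [s [a [b ->]]] f; rewrite /yangian_rel -Rinv_def.
apply: (yangian_rel_action (ev_action yangian_genop) (Lf := @Lfree K N) (Lp := @Lpred K N)
          L_linear RRinv R_Rinv).
- apply: (bilinear_gen_shift_reflection q0 RRinv R_Rinv YB RPsi (@crea_sym _ _ q R)
    (partial_crea q0 RRinv R_Rinv YB) (partial_partial q0 RRinv R_Rinv YB) d0)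
    => v; exact: erefl.
- by [].
- by [].
- move=> i j v; rewrite /Lfree mxE.
  have -> : (i == j)%:R = (i == j)%:R *: 1 :> T by rewrite scaler_nat.
  apply: (etrans (actionZ (ev_action yangian_genop) _ _ _)).
  by have [_ _ -> _] := ev_action yangian_genop.
- move=> v; rewrite -[RHS]op1_shift; apply: eq_op1 => i j w.
  by rewrite /Lfree mxE ev_gen.
- by move=> k i j v; rewrite /Lfree mxE ev_gen.
Qed.

End BraidedYangianAction.

Lemma fock_representation (K : fieldType) (N : nat)
    (q : K) (R Psi : 'M[K]_(N * N)) :
  q != 0 -> (forall n : int, n != 0 -> q ^ n != 1) ->
  hecke_symmetry q R -> skew_inverse R Psi ->
  exists rho : yangian q R -> fock q R -> fock q R,
    [/\ representation rho,
        forall (i j : 'I_N) (f : fock q R),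
          rho (Lgen q R 1 i j) f =
            \sum_k Bmx Psi k j *: creation i (annihilation k f)
            - ((i == j)%:R / (q - q^-1)) *: f
      & forall (k : nat) (i j : 'I_N) (f : fock q R),
          (2 <= k)%N -> rho (Lgen q R k i j) f = 0].
Proof.
move=> q0 q_gen [YB Hq] RPsi; have RRinv := hecke_inverse q0 Hq.
set Rinv := R - _ in RRinv.
have R_Rinv : R = Rinv + (q - q^-1)%:M by rewrite subrK.
have d0 : q - q^-1 != 0.
  rewrite subr_eq0; apply/eqP => qq; have /eqP[] := q_gen 2 isT.
  by rewrite -exprnP expr2 {1}qq mulVf.
have Rinv_invmx : invmx R = Rinv.
  have [uR _] := mulmx1_unit RRinv.
  by rewrite -[RHS]mul1mx -(mulVmx uR) -mulmxA RRinv mulmx1.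
have kill := yangian_genop_rel q0 d0 RRinv R_Rinv YB RPsi.
exists (@quot_act _ _ _ (ev (yangian_genop Psi q0 RRinv R_Rinv YB)) _); split.
- exact: quot_act_representation (ev_action _) kill.
- move=> i j f; have E : Lfree K N 1 i j = gen K (i, j, 0%N) by rewrite mxE.
  rewrite mxE E; apply: etrans (quot_act_cls (ev_action _) kill _ _) _.
  apply: etrans (ev_gen _ _ _) _.
  have -> : \sum_k Bmx Psi k j *: creation i (annihilation k f)
      = bilinear_gen Psi (crea q R) (partial q0 RRinv R_Rinv YB) i j f.
    apply: eq_bigr => k _; congr (_ *: creation i _).
    exact: (annihilation_partial q0 RRinv R_Rinv YB Rinv_invmx).
  exact: erefl.
- case=> [|[|k]] // i j f _.
  have E : Lfree K N k.+2 i j = gen K (i, j, k.+1) by rewrite mxE.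
  rewrite mxE E; apply: etrans (quot_act_cls (ev_action _) kill _ _) _.
  exact: ev_gen.
Qed.

Theorem proposition34 (RR : realType) (cplx : bool) (N : nat)
    (q : scalars RR cplx) (R Psi : 'M[scalars RR cplx]_(N * N)) :
  q != 0 -> (forall n : int, n != 0 -> q ^ n != 1) ->
  hecke_symmetry q R -> skew_inverse R Psi ->
  exists rho : yangian q R -> fock q R -> fock q R,
    [/\ representation rho,
        forall (i j : 'I_N) (f : fock q R),
          rho (Lgen q R 1 i j) f =
            \sum_k Bmx Psi k j *: creation i (annihilation k f)
            - ((i == j)%:R / (q - q^-1)) *: f
      & forall (k : nat) (i j : 'I_N) (f : fock q R),
          (2 <= k)%N -> rho (Lgen q R k i j) f = 0].
Proof. exact: fock_representation. Qed.
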